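(* We have $\bar M\in\mathcal S(M)$. Moreover, if $\psi\in\mathcal S(M)$, then $\psi(\alpha)\ge\bar M(\alpha)$ for all $\alpha\in\overline{\mathbb Q}^\times$.
   Context: $\overline{\mathbb Q}^\times$ is the multiplicative group of non-zero algebraic numbers and $\mathrm{Tor}(\overline{\mathbb Q}^\times)$ is the group of roots of unity. For $f(z)=a\prod_{n=1}^N(z-\alpha_n)\in\mathbb C[z]$ with $a\neq 0$, the (logarithmic) Mahler measure is $M(f)=\log|a|+\sum_{n=1}^N\log^+|\alpha_n|$, where $\log^+ t=\max\{\log t,0\}$ (and $\log^+0=0$). For $\alpha\in\overline{\mathbb Q}^\times$, $M(\alpha)$ denotes the Mahler measure of the minimal polynomial of $\alpha$ over $\mathbb Z$ (primitive, irreducible, with integer coefficients). The modified Mahler measure is $\bar M(\alpha)=\inf\{M(\zeta\alpha):\zeta\in\mathrm{Tor}(\overline{\mathbb Q}^\times)\}$. Let $\mathcal X(\overline{\mathbb Q}^\times)$ be the set of sequences $(\alpha_1,\alpha_2,\ldots)$ in $\overline{\mathbb Q}^\times$ with $\alpha_n=1$ for all but finitely many $n$, and $\tau(\alpha_1,\alpha_2,\ldots)=\prod_{n=1}^\infty\alpha_n$. For a function $\phi:\overline{\mathbb Q}^\times\to[0,\infty)$ satisfying $$( * )\qquad\phi(1)=0\quad\text{and}\quad\phi(\alpha)=\phi(\alpha^{-1})\text{ for all }\alpha\in\overline{\mathbb Q}^\times,$$ and for $x\in(0,\infty]$, put $\phi_x(\alpha_1,\alpha_2,\ldots)=\left(\sum_{n=1}^\infty\phi(\alpha_n)^x\right)^{1/x}$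 if $x<\infty$, $\phi_\infty(\alpha_1,\alpha_2,\ldots)=\max_{n\ge1}\phi(\alpha_n)$, and, for $\alpha\in\overline{\mathbb Q}^\times$, $\phi_x(\alpha)=\inf\{\phi_x(\bar\alpha):\bar\alpha\in\tau^{-1}(\alpha)\}$. The Mahler measure $M$ satisfies $( * )$, and $M_x$ denotes this construction applied to $\phi=M$. $\mathcal S(M)$ is the set of all functions $\phi:\overline{\mathbb Q}^\times\to[0,\infty)$ satisfying $( * )$ such that $\phi_x(\alpha)=M_x(\alpha)$ for all $\alpha\in\overline{\mathbb Q}^\times$ and all $x\in(0,\infty]$. *)

(* Defs.v *)
From HB Require Import structures.
From mathcomp Require Import all_boot all_order all_algebra.
From mathcomp Require Import complex.
From mathcomp Require Import all_classical all_reals all_analysis.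

Set Implicit Arguments.
Unset Strict Implicit.
Unset Printing Implicit Defensive.

Import Order.TTheory GRing.Theory Num.Theory.

Local Open Scope classical_set_scope.
Local Open Scope ring_scope.
Local Open Scope complex_scope.

(* The multiplicative group of nonzero algebraic numbers, inside R[i]. *)
Definition is_Qbarx (R : realType) : {pred R[i]} :=
  fun z => (z != 0) && `[< algebraicOver (ratr : rat -> R[i]) z >].

Definition Qbarx (R : realType) : Type := {z : R[i] | z \in @is_Qbarx R}.

HB.instance Definition _ (R : realType) := SubType.on (Qbarx R).
HB.instance Definition _ (R : realType) := Choice.on (Qbarx R).

Section QbarxGroup.
Variable R : realType.
Implicit Types z w : R[i].

Lemma is_Qbarx1 : (1 : R[i]) \in @is_Qbarx R.
Proof. by apply/andP; split; [exact: oner_neq0|apply/asboolP/algebraic1]. Qed.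

Lemma is_QbarxM z w :
  z \in @is_Qbarx R -> w \in @is_Qbarx R -> z * w \in @is_Qbarx R.
Proof.
move=> /andP[z0 /asboolP za] /andP[w0 /asboolP wa]; apply/andP; split.
  by rewrite mulf_neq0.
by apply/asboolP; exact: algebraic_mul.
Qed.

Lemma is_QbarxV z : z \in @is_Qbarx R -> z^-1 \in @is_Qbarx R.
Proof.
move=> /andP[z0 /asboolP za]; apply/andP; split; first by rewrite invr_eq0.
by apply/asboolP; exact: algebraic_inv.
Qed.

Definition Qbarx_one : Qbarx R := exist _ 1 is_Qbarx1.
Definition Qbarx_mul (a b : Qbarx R) : Qbarx R :=
  exist _ (val a * val b) (is_QbarxM (valP a) (valP b)).
Definition Qbarx_inv (a : Qbarx R) : Qbarx R :=
  exist _ (val a)^-1 (is_QbarxV (valP a)).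

Lemma Qbarx_mulA : associative Qbarx_mul.
Proof. by move=> a b c; apply: val_inj; rewrite /= mulrA. Qed.

Lemma Qbarx_mulC : commutative Qbarx_mul.
Proof. by move=> a b; apply: val_inj; rewrite /= mulrC. Qed.

Lemma Qbarx_mul1 : left_id Qbarx_one Qbarx_mul.
Proof. by move=> a; apply: val_inj; rewrite /= mul1r. Qed.

Lemma Qbarx_mulr1 : right_id Qbarx_one Qbarx_mul.
Proof. by move=> a; apply: val_inj; rewrite /= mulr1. Qed.

Lemma Qbarx_mulV : left_inverse Qbarx_one Qbarx_inv Qbarx_mul.
Proof.
by move=> a; apply: val_inj; rewrite /= mulVf //; case/andP: (valP a).
Qed.

Lemma Qbarx_mulrV : right_inverse Qbarx_one Qbarx_inv Qbarx_mul.
Proof. by move=> a; rewrite Qbarx_mulC Qbarx_mulV. Qed.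

HB.instance Definition _ := isGroup.Build (Qbarx R)
  Qbarx_mulA Qbarx_mul1 Qbarx_mulr1 Qbarx_mulV Qbarx_mulrV.

HB.instance Definition _ := SemiGroup.isCommutativeLaw.Build
  (Qbarx R) (@monoid.mul (Qbarx R)) Qbarx_mulC.

End QbarxGroup.

Section Mahler.
Variable R : realType.

(* [ln 0 = 0], so [logp 0 = 0]. *)
Definition logp (t : R) : R := Num.max (ln t) 0.

Definition cnorm (z : R[i]) : R := complex.Re `|z|.

(* The roots of f, repeated according to multiplicity; for f != 0,
   f = lead_coef f *: \prod_(z <- croots f) ('X - z%:P). *)
Definition croots (f : {poly R[i]}) : seq R[i] :=
  sval (closed_field_poly_normal f).

Definition mahler_poly (f : {poly R[i]}) : R :=
  ln (cnorm (lead_coef f)) + \sum_(z <- croots f) logp (cnorm z).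

(* [zcontents p] carries the sign of [lead_coef p], so [zcontents p = 1] says
   that p is primitive with positive leading coefficient; the latter removes
   the sign ambiguity.  For primitive p of positive degree, irreducibility
   over rat and over int agree. *)
Definition is_minpolyZ (a : Qbarx R) : set {poly int} :=
  [set p | [/\ irreducible_poly (map_poly (intr : int -> rat) p),
               zcontents p = 1
             & root (map_poly (intr : int -> R[i]) p) (val a)]].

Definition minpolyZ (a : Qbarx R) : {poly int} := xget 0 (is_minpolyZ a).

Definition mahler (a : Qbarx R) : R :=
  mahler_poly (map_poly (intr : int -> R[i]) (minpolyZ a)).

Definition Tor : set (Qbarx R) :=
  [set z | exists2 n, (0 < n)%N & (z ^+ n)%g = 1%g].

Definition mahler_bar (a : Qbarx R) : R :=
  inf [set mahler (z * a)%g | z in Tor].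

End Mahler.

Section Metric.
Variable R : realType.
Implicit Types phi psi : Qbarx R -> R.

Definition almost_one : set (nat -> Qbarx R) :=
  [set s | finite_set [set n | s n <> 1%g]].

Definition tau (s : nat -> Qbarx R) : Qbarx R :=
  \big[*%g/1%g]_(n \in [set: nat]) s n.

Definition admissible : set (Qbarx R -> R) :=
  [set phi | [/\ forall a, 0 <= phi a, phi 1%g = 0
               & forall a, phi a = phi a^-1%g]].

(* The sum and the maximum run over the finitely many n where the summand is
   nonzero, as phi 1 = 0 and s is eventually 1; the exponent is only meant to range
   over ]0, +oo], and the value at -oo is irrelevant. *)
Definition seq_norm phi (x : \bar R) (s : nat -> Qbarx R) : R :=
  match x with
  | r%:E => (\sum_(n \in [set: nat]) phi (s n) `^ r) `^ r^-1
  | +oo%E => \big[Num.max/0]_(n \in [set: nat]) phi (s n)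
  | -oo%E => 0
  end.

Definition elt_norm phi (x : \bar R) (a : Qbarx R) : R :=
  inf [set seq_norm phi x s | s in almost_one `&` tau @^-1` [set a]].

Definition calS phi : set (Qbarx R -> R) :=
  [set psi | admissible psi /\
     forall x : \bar R, (0 < x)%E ->
       forall a, elt_norm psi x a = elt_norm phi x a].

End Metric.

(* Main.v *)
From HB Require Import structures.
Require Import Defs.
From mathcomp Require Import all_boot all_order all_algebra all_fingroup all_field.
From mathcomp Require Import boolp.

(* For [mahler_bar] in S(M): twist every entry of a factorization by a root of unity
   so that M comes close to [mahler_bar]; the twists multiply to a root of unity,
   which is compensated by one more entry, on which M vanishes.

   For minimality, psi(a) >= psi_x(a) = M_x(a) for every x. As x tends to 0, the
   x-norm of a factorization with two entries of Mahler measure >= c is at least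
   2^(1/x) c, which is unbounded. So it is enough to find c > 0, depending only on a,
   such that a = g * u_1 * ... * u_k with all M(u_i) < c implies
   mahler_bar(a) <= M(g).

   Let G be the Galois group of a large normal field and H its subgroup fixing all
   conjugates of a. The roots of the minimal polynomial l X^n + ... of u split into
   at most D = D(a) H-orbits B; put N_B for the product of B. The polynomials
   l^m prod_B (X - N_B^m) are G-invariant and have integral coefficients (because l
   times a product of distinct roots is an algebraic integer), and their Mahler
   measure is at most m M(u). If M(u) is small, many of them have bounded
   coefficients, two of them agree, and every N_B is a root of unity. Taking norms
   along H in a = g * u_1 * ... * u_k then shows that a^d / N_B is a root of unity
   for the orbit B of g, with d = #|B|. Hence some zeta * a with zeta a root of unity
   is a root of l prod_B (X^d - N_B), whose Mahler measure is at most M(g). *)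

Set Implicit Arguments.
Unset Strict Implicit.
Unset Printing Implicit Defensive.

Import Order.TTheory GRing.Theory Num.Theory.
Local Open Scope ring_scope.

(** * Number fields inside an algebraically closed field *)

Section Closure.
Variable C : numClosedFieldType.
Local Notation QC := (map_poly (ratr : rat -> C)).
Local Notation algebraic := (algebraicOver (ratr : rat -> C)).

(** Induction with the primitive element theorem for two elements. The expression of [z] as a
    combination of [s] with natural coefficients later places [z] in the field generated by the
    preimages of [s]. *)
Lemma primitive_element_seq (s : seq C) : (forall x, x \in s -> algebraic x) ->
  exists z, [/\ algebraic z,
    exists a : nat -> nat, z = \sum_(i < size s) s`_i *+ a i &
    forall x, x \in s -> exists p, x = (QC p).[z]].
Proof.
elim: s => [|x s IHs] alg_s.
  exists 0; split=> //; first exact: algebraic0.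
  by exists (fun=> 0%N); rewrite big_ord0.
have [|z [alg_z [a Dz] Ds]] := IHs.
  by move=> y sy; apply: alg_s; rewrite inE sy orbT.
have [rx nz_rx rx0] : algebraic x by apply: alg_s; rewrite mem_head.
(* The two-element theorem yields [x *+ n - y]; with [y := - z] this becomes a sum. *)
have [rz nz_rz rz0] := algebraic_opp alg_z.
have pchar0_Q: [pchar rat] =i pred0 by apply: pchar_num.
have [n [[pz Dpz] [px Dpx]]] := pchar0_PET nz_rz rz0 nz_rx rx0 pchar0_Q.
rewrite opprK in Dpz Dpx.
exists (x *+ n + z); split.
- apply: algebraic_add => //; rewrite -mulr_natr -(ratr_nat _ n).
  apply: algebraic_mul; last exact: algebraic_id.
  by apply: alg_s; rewrite mem_head.
- exists (fun i => if i is j.+1 then a j else n).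
  by rewrite Dz big_ord_recl.
move=> y; rewrite inE => /predU1P[-> | /Ds[p ->]]; first by exists px.
exists (p \Po - pz).
by rewrite map_comp_poly horner_comp rmorphN /= hornerN Dpz opprK.
Qed.

Lemma irreducible_root (x : C) : algebraic x ->
  exists p, [/\ p != 0, root (QC p) x & irreducible_poly p].
Proof.
case=> p; have [n] := ubnP (size p); elim: n p => // n IHn p lt_p_n nz_p px.
have [[q [nz_q qx lt_q_p]]|min_p] :=
    pselect (exists q, [/\ q != 0, root (QC q) x & (size q < size p)%N]).
  by apply: (IHn q) => //; apply: leq_trans lt_q_p _.
exists p; split=> //; apply/(subfx_irreducibleP px nz_p) => q qx nz_q.
by rewrite leqNgt; apply/negP => lt_q_p; apply: min_p; exists q.
Qed.

(** [L] is the quotient of Q[X] by an irreducible polynomial of a primitive element [z], embedded by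
    sending the class of X to [z]. *)
Lemma number_field_exists (s : seq C) : (forall x, x \in s -> algebraic x) ->
  exists (L : fieldExtType rat) (iota : {rmorphism L -> C}) (s1 : seq L),
    map iota s1 = s /\ <<1 & s1>>%VS = fullv.
Proof.
move=> /primitive_element_seq[z [alg_z [a Dz] Ds]].
have [r [nz_r rz irr_r]] := irreducible_root alg_z.
pose L := SubFieldExtType rz irr_r : fieldExtType rat.
pose iota : {rmorphism L -> C} := @subfx_inj _ _ (ratr : {rmorphism rat -> C}) z r.
pose z1 : L := subfx_root (ratr : {rmorphism rat -> C}) z r.
have iz1 : iota z1 = z by exact: subfx_inj_root.
have hornerL (p : {poly rat}) : iota (map_poly (in_alg L) p).[z1] = (QC p).[z].
  rewrite -horner_map iz1 -map_poly_comp; congr _.[z].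
  by apply: eq_map_poly => b /=; rewrite alg_num_field fmorph_rat.
have [s1 Ds1] : exists s1, map iota s1 = s.
  elim: (s) Ds => [|x t IHt] Dt; first by exists [::].
  have [|t1 <-] := IHt; first by move=> y ty; apply: Dt; rewrite inE ty orbT.
  have [p ->] := Dt x (mem_head _ _).
  by exists ((map_poly (in_alg L) p).[z1] :: t1); rewrite /= hornerL.
exists L, iota, s1; split=> //; apply/vspaceP=> x; rewrite memvf.
have [p ->] : exists p, x = (map_poly (in_alg L) p).[z1].
  by have [p ->] := subfxEroot rz nz_r x; exists p.
have z1_gen : z1 \in <<1 & s1>>%AS.
  suff -> : z1 = \sum_(i < size s1) s1`_i *+ a i.
    by apply: rpred_sum => i _; rewrite rpredMn ?seqv_sub_adjoin ?mem_nth.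
  apply: (fmorph_inj iota); rewrite iz1 Dz rmorph_sum -Ds1 size_map.
  by apply: eq_bigr => i _; rewrite rmorphMn /= (nth_map 0).
apply: (@rpred_horner _ <<1 & s1>>%AS) => //.
by apply/polyOverP => i; rewrite coef_map; apply: memvZ; apply: mem1v.
Qed.

(** The roots of [p] in [C] generate a splitting field, which is Galois in characteristic zero. *)
Lemma galois_closure_exists (p : {poly rat}) : p != 0 ->
  exists (L : splittingFieldType rat) (iota : {rmorphism L -> C}) (rs : seq L),
    galois 1 {:L} /\
    map_poly (in_alg L) p = in_alg L (lead_coef p) *: \prod_(x <- rs) ('X - x%:P).
Proof.
move=> nz_p; have [s Ds] := closed_field_poly_normal (QC p).
have [|L [iota [rs [Drs genL]]]] := @number_field_exists s.
  move=> x sx; exists p => //; rewrite Ds rootZ ?lead_coef_eq0 ?map_poly_eq0 //.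
  by rewrite root_prod_XsubC.
have Dp : map_poly (in_alg L) p = in_alg L (lead_coef p) *: \prod_(x <- rs) ('X - x%:P).
  apply: (map_inj_poly (fmorph_inj iota)); first exact: rmorph0.
  rewrite -map_poly_comp (eq_map_poly (g := ratr)); last first.
    by move=> b /=; rewrite alg_num_field fmorph_rat.
  rewrite Ds linearZ /= alg_num_field fmorph_rat lead_coef_map rmorph_prod -Drs big_map.
  by congr (_ *: _); apply: eq_bigr => y _; rewrite /= map_polyXsubC.
have axL : FieldExt_isSplittingField _ L.
  constructor; exists (map_poly (in_alg L) p).
    by apply/polyOverP => i; rewrite coef_map; apply: memvZ; apply: mem1v.
  by exists rs => //; rewrite Dp eqp_scale // fmorph_eq0 ?lead_coef_eq0 //.
pose L' : splittingFieldType rat := HB.pack_for (splittingFieldType rat) L axL.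
exists L', iota, rs; split=> //; apply/and3P; split.
- exact: sub1v.
- by apply/separableP => y _; apply: pcharf0_separable => q; rewrite pchar_lalg pchar_num.
- exact: normalFieldf.
Qed.
End Closure.

(** * Integrality of products of roots *)

Section Integrality.
Variable K : fieldType.
Local Notation integral := (integralOver (intr : int -> K)).
Implicit Types p g : {poly K}.

Lemma integral_exp (x : K) n : integral x -> integral (x ^+ n).
Proof.
move=> ix; elim: n => [|n IHn]; first by rewrite expr0; apply: integral1.
by rewrite exprS; apply: integral_mul.
Qed.

(** With c the leading coefficient and n the degree, c^(n-1) p(r) = 0 is a monic equation for c r
    with integral coefficients. *)
Lemma integral_lead_coef_mul_root p r : p != 0 -> root p r ->
  (forall i, integral p`_i) -> integral (lead_coef p * r).
Proof.
move=> nz_p pr int_p; pose n := (size p).-1; pose c := lead_coef p.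
have Dsz : size p = n.+1 by rewrite prednK // size_poly_gt0.
have n_gt0 : (0 < n)%N.
  rewrite lt0n; apply: contraTneq pr => n0.
  have /size_poly1P[a nz_a ->] : size p == 1%N by rewrite Dsz n0.
  by rewrite rootE hornerC.
pose q := 'X^n + \poly_(i < n) (c ^+ (n.-1 - i) * p`_i).
apply: (@integral_root_monic _ _ _ _ q).
- rewrite monicE lead_coefDl ?lead_coefXn // size_polyXn ltnS.
  exact: size_poly.
- rewrite rootE hornerD hornerXn horner_poly.
  suff -> : (c * r) ^+ n + \sum_(i < n) c ^+ (n.-1 - i) * p`_i * (c * r) ^+ i
            = c ^+ n.-1 * p.[r] by rewrite (rootP pr) mulr0.
  rewrite horner_coef Dsz big_ord_recr /= mulrDr addrC mulr_sumr; congr (_ + _).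
    apply: eq_bigr => i _; rewrite exprMn mulrAC mulrA -exprD subnK.
      by rewrite -!mulrA; congr (_ * _); rewrite mulrC.
    by rewrite -ltnS prednK.
  by rewrite exprMn -[in c ^+ n](prednK n_gt0) exprSr -!mulrA.
apply/integral_poly => i; rewrite coefD coefXn coef_poly.
apply: integral_add; first exact: integral_nat.
case: ifP => _; last exact: integral0.
by apply: integral_mul => //; apply/integral_exp/int_p.
Qed.

(** Induction on the degree: removing the leading term c X^m of [g] changes (X - r) g by - c X^(m+1)
    + c r X^m, and c r is integral because [r] is a root of (X - r) g, whose leading coefficient is
    c. *)
Lemma integral_divXsubC g r : (forall i, integral (('X - r%:P) * g)`_i) ->
  forall i, integral g`_i.
Proof.
have [n] := ubnP (size g); elim: n g => // n IHn g le_g_n int_p.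
have [->|nz_g] := eqVneq g 0; first by move=> i; rewrite coef0; apply: integral0.
pose c := lead_coef g; pose m := (size g).-1.
have Dsz : size g = m.+1 by rewrite prednK // size_poly_gt0.
have Dlc : lead_coef (('X - r%:P) * g) = c.
  by rewrite lead_coefM lead_coefXsubC mul1r.
have int_c : integral c by rewrite -Dlc; apply: int_p.
have int_cr : integral (c * r).
  rewrite -Dlc; apply: integral_lead_coef_mul_root int_p.
    by rewrite mulf_neq0 // polyXsubC_eq0.
  by rewrite rootM root_XsubC eqxx.
have IHg : forall i, integral (g - c *: 'X^m)`_i.
  apply: IHn => [|i].
    apply: leq_trans (le_g_n : size g <= n)%N; rewrite Dsz ltnS.
    apply/leq_sizeP => j; rewrite leq_eqVlt => /predU1P[<- | lt_mj].
      by rewrite coefB coefZ coefXn eqxx mulr1 subrr.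
    rewrite coefB coefZ coefXn gtn_eqF // mulr0 subr0.
    by rewrite nth_default // Dsz.
  rewrite mulrBr coefB; apply: integral_sub => //.
  rewrite -scalerAr coefZ mulrBl -exprS coefB coefXn coefCM coefXn mulrBr.
  apply: integral_sub; first by apply: integral_mul => //; apply: integral_nat.
  by rewrite mulrA; apply: integral_mul => //; apply: integral_nat.
move=> i; rewrite -[g](subrK (c *: 'X^m)) coefD; apply: integral_add => //.
by rewrite coefZ coefXn; apply: integral_mul => //; apply: integral_nat.
Qed.

(** Removing the factors from [t] one at a time keeps the coefficients integral. What remains has,
    up to sign, the constant term c times the product of [s]. *)
Lemma integral_subprod (c : K) (s t : seq K) :
    (forall i, integral (c *: \prod_(x <- s ++ t) ('X - x%:P))`_i) ->
  integral (c * \prod_(x <- s) x).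
Proof.
elim: t => [|x t IHt] int_p; last first.
  apply: IHt; apply: (@integral_divXsubC _ x) => i; have := int_p i.
  rewrite -scalerAr; congr (integral (c *: _ : {poly K})`_i).
  by rewrite !big_cat big_cons /= mulrCA.
have := int_p 0%N; rewrite cats0 coefZ -horner_coef0 horner_prod.
have -> : \prod_(x <- s) ('X - x%:P).[0] = (-1) ^+ size s * \prod_(x <- s) x.
  elim: (s) => [|x u IHu]; first by rewrite !big_nil mulr1.
  by rewrite !big_cons IHu /= exprS hornerXsubC sub0r mulN1r !mulNr mulrCA.
rewrite mulrCA => /(integral_mul (integral_exp (size s) (integral_opp (integral1 _)))).
by rewrite signrMK.
Qed.
End Integrality.

(** A monic integer equation for [iota q] is one for [q]; it is transferred to [algC], where
    rational algebraic integers are integers. *)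
Lemma rat_integral (q : rat) (K : fieldType) (iota : {rmorphism rat -> K}) :
  integralOver (intr : int -> K) (iota q) -> exists n : int, q = n%:~R.
Proof.
case=> p mon_p; move=> root_q.
move: root_q; rewrite (eq_map_poly (g := iota \o intr)); last first.
  by move=> n; rewrite /= rmorph_int.
rewrite map_poly_comp fmorph_root => pq.
have /Cint_rat_Aint : (ratr q : algC) \in Crat by apply: Crat_rat.
have Aq : (ratr q : algC) \in Aint.
  apply: (@root_monic_Aint (map_poly intr p)).
  - rewrite (eq_map_poly (g := ratr \o intr)); last by move=> n; rewrite /= rmorph_int.
    by rewrite map_poly_comp fmorph_root.
  - exact: monic_map.
  - by apply/polyOverP => i; rewrite coef_map intr_int.
move/(_ Aq)/intrP => [n Dn]; exists n; apply: (fmorph_inj (ratr : {rmorphism rat -> algC})).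
by rewrite /= Dn ratr_int.
Qed.

(** * Orbits of roots under a normal subgroup of the Galois group *)

(** Up to sign, the coefficients are sums of c times products over subsequences of [s]; the
    induction absorbs a root into the constant. *)
Lemma integral_scale_prodXsubC (K : fieldType) (c : K) (s : seq K) :
    (forall t, subseq t s -> integralOver (intr : int -> K) (c * \prod_(x <- t) x)) ->
  forall i, integralOver (intr : int -> K) (c *: \prod_(x <- s) ('X - x%:P))`_i.
Proof.
elim: s c => [|x s IHs] c int_c i.
  rewrite big_nil coefZ coef1; apply: integral_mul; last exact: integral_nat.
  by have := int_c [::] isT; rewrite big_nil mulr1.
rewrite big_cons mulrBl scalerBr coefB; apply: integral_sub.
  rewrite scalerAr coefXM; case: ifP => _; first exact: integral0.
  by apply: IHs => t st; apply: int_c; apply: subseq_trans st (subseq_cons s x).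
rewrite mul_polyC scalerA; apply: IHs => t st.
by have := int_c (x :: t); rewrite /= eqxx big_cons mulrA; apply.
Qed.

Section Blocks.
Variable L : splittingFieldType rat.
Hypothesis galL : galois 1 {:L}.
Local Notation G := (gal_of {:L}).
Implicit Types (g h : G) (x y : L).

Lemma gal_mulE g h x : (g * h)%g x = h (g x).
Proof. by rewrite galM ?memvf. Qed.

Lemma gal_oneE x : (1%g : G) x = x.
Proof. by rewrite gal_id. Qed.

Lemma gal_invKE g x : g (g^-1%g x) = x.
Proof. by rewrite -gal_mulE mulVg gal_oneE. Qed.

Lemma gal_KinvE g x : g^-1%g (g x) = x.
Proof. by rewrite -gal_mulE mulgV gal_oneE. Qed.

Lemma gal_fixed_rat x : (forall g, g x = x) -> exists q : rat, x = in_alg L q.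
Proof.
move=> fix_x; have /vlineP[q ->] : x \in 1%VS.
  rewrite -(galois_fixedField galL); apply/fixedFieldP; first exact: memvf.
  by move=> g _.
by exists q.
Qed.

Lemma gal_intr_poly g (f : {poly int}) :
  map_poly g (map_poly intr f) = map_poly intr f :> {poly L}.
Proof.
rewrite -map_poly_comp; apply: eq_map_poly => n.
by rewrite /= rmorph_int.
Qed.

Lemma intr_num_field_eq0 (n : int) : (n%:~R == 0 :> L) = (n == 0).
Proof. by rewrite -(rmorph_int (in_alg L)) fmorph_eq0 intr_eq0. Qed.

Section Fixer.
Variable ws : seq L.
Hypothesis gal_ws : forall g x, x \in ws -> g x \in ws.

(** The subgroup H of the overview: the Galois group of L over the field generated by [ws]. It is
    normal by [fixer_conj]. *)
Definition fixer : {set G} := [set g : G | all (fun w => g w == w) ws].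

Lemma fixerP g : reflect {in ws, forall w, g w = w} (g \in fixer).
Proof.
by rewrite inE; apply: (iffP allP) => fix_g w /fix_g => [/eqP|->].
Qed.

Lemma fixer_group_set : group_set fixer.
Proof.
apply/group_setP; split=> [|g h /fixerP Hg /fixerP Hh]; apply/fixerP => w ws_w.
  exact: gal_oneE.
by rewrite gal_mulE Hg // Hh.
Qed.
Canonical fixer_group := Group fixer_group_set.

Lemma fixer_conj g h : h \in fixer -> (h ^ g)%g \in fixer.
Proof.
move/fixerP=> Hh; apply/fixerP => w ws_w.
by rewrite conjgE !gal_mulE Hh ?gal_invKE ?gal_ws.
Qed.

(** The relative norm from L to the fixed field of [fixer]. *)
Definition fixer_norm x : L := \prod_(h in fixer) h x.

Lemma fixer_norm_gal h x : h \in fixer -> fixer_norm (h x) = fixer_norm x.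
Proof.
move=> Hh; rewrite /fixer_norm [RHS](reindex_inj (mulgI h)) /=.
by apply: eq_big => [k|k _]; rewrite ?groupMl // gal_mulE.
Qed.

Section Roots.
Variable f : {poly int}.
Variable rs : seq L.
Hypothesis uniq_rs : uniq rs.
Hypothesis Df : map_poly intr f = (lead_coef f)%:~R *: \prod_(x <- rs) ('X - x%:P).
Hypothesis nz_f : f != 0.
Hypothesis trans_rs : {in rs &, forall x y, exists g : G, g x = y}.

Local Notation T := (seq_sub rs).
Implicit Types (u v : T) (B : {set T}).

Lemma mem_roots x : (x \in rs) = root (map_poly intr f : {poly L}) x.
Proof.
by rewrite Df rootZ ?root_prod_XsubC // intr_num_field_eq0 lead_coef_eq0.
Qed.

Lemma gal_roots g x : x \in rs -> g x \in rs.
Proof. by rewrite !mem_roots -[in X in _ -> X](gal_intr_poly g) fmorph_root. Qed.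

(** The default [u] is never taken, since [g] permutes [rs]. *)
Definition root_act g u : T := insubd u (g (val u)).

Lemma val_act g u : val (root_act g u) = g (val u).
Proof. by rewrite insubdK // gal_roots ?ssvalP. Qed.

Lemma act_mulE g h u : root_act (g * h)%g u = root_act h (root_act g u).
Proof. by apply: val_inj; rewrite !val_act gal_mulE. Qed.

Lemma act_invKE g u : root_act g (root_act g^-1%g u) = u.
Proof. by apply: val_inj; rewrite !val_act gal_invKE. Qed.

Lemma act_KinvE g u : root_act g^-1%g (root_act g u) = u.
Proof. by apply: val_inj; rewrite !val_act gal_KinvE. Qed.

Lemma act_inj g : injective (root_act g).
Proof. exact: can_inj (act_KinvE g). Qed.

Definition same_orbit u v := [exists h in fixer, root_act h u == v].

Lemma same_orbitP u v : reflect (exists2 h, h \in fixer & root_act h u = v) (same_orbit u v).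
Proof.
apply: (iffP existsP) => [[h /andP[Hh /eqP]]|[h Hh <-]]; first by exists h.
by exists h; rewrite Hh eqxx.
Qed.

Lemma same_orbit_equiv : {in [set: T] & &, equivalence_rel same_orbit}.
Proof.
move=> u v w _ _ _; split=> [|/same_orbitP[h Hh <-]].
  apply/same_orbitP; exists 1%g; rewrite ?group1 //.
  by apply: val_inj; rewrite val_act gal_oneE.
apply/same_orbitP/same_orbitP => -[k Hk <-].
  by exists (h^-1 * k)%g; rewrite ?groupM ?groupV // act_mulE act_KinvE.
by exists (h * k)%g; rewrite ?groupM // act_mulE.
Qed.

Definition blocks := equivalence_partition same_orbit [set: T].

Lemma blocksP : partition blocks [set: T].
Proof. exact: equivalence_partitionP same_orbit_equiv. Qed.

Definition orb u : {set T} := [set v | same_orbit u v].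

Lemma mem_blocks B : reflect (exists u, B = orb u) (B \in blocks).
Proof.
apply: (iffP imsetP) => [[u _ ->]|[u ->]]; exists u => //.
  by apply/setP => v; rewrite !inE.
by apply/setP => v; rewrite !inE.
Qed.

Lemma orb_id u : u \in orb u.
Proof.
rewrite inE; apply/same_orbitP.
by exists 1%g; rewrite ?group1 //; apply: val_inj; rewrite val_act gal_oneE.
Qed.

Lemma orb_eq u v : v \in orb u -> orb v = orb u.
Proof.
rewrite inE => euv; apply/setP => w; rewrite !inE.
by have [_ /(_ euv)] := same_orbit_equiv (in_setT u) (in_setT v) (in_setT w).
Qed.

(** Normality of [fixer] at work: if h moves v to w, then its conjugate by k moves k v to k w. The
    reverse inclusion follows by applying the inverse of [g]. *)
Lemma orb_act g u : root_act g @: orb u = orb (root_act g u).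
Proof.
have sub k v : root_act k @: orb v \subset orb (root_act k v).
  apply/subsetP => _ /imsetP[w /[!inE] /same_orbitP[h Hh <-] ->].
  apply/same_orbitP; exists (h ^ k)%g; first exact: fixer_conj.
  by rewrite -!act_mulE conjgE !mulgA mulgV mul1g.
apply/eqP; rewrite eqEsubset sub; apply/subsetP => v guv.
rewrite -(act_invKE g v); apply: imset_f.
by rewrite -[u](act_KinvE g); apply: (subsetP (sub _ _)); apply: imset_f.
Qed.

Lemma act_imsetKinv g B : root_act g^-1%g @: (root_act g @: B) = B.
Proof. by rewrite -imset_comp -[RHS]imset_id; apply: eq_imset => u /=; apply: act_KinvE. Qed.

Lemma blocks_act g B : (root_act g @: B \in blocks) = (B \in blocks).
Proof.
have sub k C : C \in blocks -> root_act k @: C \in blocks.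
  by case/mem_blocks => u ->; apply/mem_blocks; exists (root_act k u); rewrite orb_act.
by apply/idP/idP => [/(sub g^-1%g)|]; [rewrite act_imsetKinv | apply: sub].
Qed.

Definition block_prod B : L := \prod_(u in B) val u.

Lemma block_prod_act g B : block_prod (root_act g @: B) = g (block_prod B).
Proof.
rewrite /block_prod big_imset /=; last by move=> u v _ _; apply: act_inj.
by rewrite rmorph_prod; apply: eq_bigr => u _; apply: val_act.
Qed.

(* [block_prod B] is the norm of a root in B from the field it generates over the
   fixed field of [fixer], whence the exponents. *)
Lemma block_prod_norm u : block_prod (orb u) ^+ #|fixer| = fixer_norm (val u) ^+ #|orb u|.
Proof.
have -> : block_prod (orb u) ^+ #|fixer| = \prod_(h in fixer) h (block_prod (orb u)).
  rewrite -prodr_const; apply: eq_bigr => h Hh.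
  rewrite -block_prod_act orb_act (@orb_eq u) // inE; apply/same_orbitP.
  by exists h.
rewrite -prodr_const; under eq_bigr do rewrite rmorph_prod.
rewrite exchange_big; apply: eq_bigr => v /[!inE] /same_orbitP[h Hh <-].
by rewrite val_act -(fixer_norm_gal _ Hh).
Qed.

Lemma roots_blocks : perm_eq rs (flatten [seq [seq val u | u <- enum B] | B <- enum blocks]).
Proof.
apply: prod_XsubC_eq; rewrite big_flatten big_map big_enum /=.
under [RHS]eq_bigr do rewrite big_map big_enum.
rewrite -(@set_partition_big _ _ _ _ _ _ (fun u => 'X - (val u)%:P) blocksP) /=.
rewrite -{1}(val_seq_sub_enum uniq_rs) big_map.
rewrite [RHS](eq_bigl xpredT) => [|u]; last by rewrite in_setT.
apply/perm_big/uniq_perm; [|exact: index_enum_uniq|].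
  by apply: (@map_uniq _ _ val); rewrite val_seq_sub_enum.
by move=> u; rewrite mem_seq_sub_enum mem_index_enum.
Qed.

(** By transitivity every block is the image of a fixed one under some g. It depends only on the
    restriction of g to [ws], since two elements with equal restrictions differ by one of [fixer].
    So the self-maps of [ws] bound the number of blocks. *)
Lemma card_blocks : uniq ws -> (#|blocks| <= size ws ^ size ws)%N.
Proof.
move=> uniq_ws; have [->|[B0 /mem_blocks[u0 _]]] := set_0Vmem blocks.
  by rewrite cards0.
have /fin_all_exists[g_ g_orb] B : exists g : G, B \in blocks -> root_act g @: orb u0 = B.
  have [/mem_blocks[u ->]|] := boolP (B \in blocks); last by exists 1%g.
  have [g Dg] := trans_rs (ssvalP u0) (ssvalP u); exists g => _.
  by rewrite orb_act; congr orb; apply: val_inj; rewrite val_act.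
pose phi B : {ffun seq_sub ws -> seq_sub ws} := [ffun w => insubd w (g_ B (val w))].
rewrite -[size ws](card_seq_sub uniq_ws) -card_ffun -(card_in_imset (f := phi)).
  exact: max_card.
move=> B B' PB PB' eq_phi; rewrite -(g_orb B PB) -(g_orb B' PB') !orb_act.
apply/esym/orb_eq; rewrite inE; apply/same_orbitP.
exists ((g_ B)^-1 * g_ B')%g; last by rewrite act_mulE act_KinvE.
apply/fixerP => w ws_w; rewrite gal_mulE.
have ws_w1 := gal_ws (g_ B)^-1%g ws_w.
have := congr1 (fun p : {ffun _ -> _} => val (p (SeqSub ws_w1))) eq_phi.
by rewrite !ffunE !insubdK /= ?gal_ws // gal_invKE.
Qed.

(** Invariance makes the coefficients rational, and integrality then makes them integers. *)
Lemma gal_invariant_poly (p : {poly L}) :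
    (forall g, map_poly g p = p) ->
    (forall i, integralOver (intr : int -> L) p`_i) ->
  exists q : {poly int}, p = map_poly intr q.
Proof.
move=> fix_p int_p.
have /choice[c Dc] i : exists n : int, p`_i = n%:~R.
  have [|q Dq] := @gal_fixed_rat p`_i.
    by move=> g; rewrite -[in RHS](fix_p g) coef_map.
  have := int_p i; rewrite Dq => /rat_integral[n ->]; exists n.
  by rewrite rmorph_int.
exists (\poly_(i < size p) c i); apply/polyP => i; rewrite coef_map coef_poly.
by case: ltnP => [_|/(nth_default 0) ->]; rewrite ?Dc.
Qed.

(** The Galois group permutes the blocks, hence the factors. For integrality, with l the leading
    coefficient of [f], l^m times the m-th powers of some block products is the m-th power of l
    times a product of distinct roots. *)
Lemma blocks_poly m : exists q : {poly int},
  map_poly intr q =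
    (lead_coef f)%:~R ^+ m *: \prod_(B in blocks) ('X - (block_prod B ^+ m)%:P) :> {poly L}.
Proof.
pose p : {poly L} :=
  (lead_coef f)%:~R ^+ m *: \prod_(B in blocks) ('X - (block_prod B ^+ m)%:P).
suff [q Dq] : exists q : {poly int}, p = map_poly intr q by exists q; rewrite -Dq.
apply: gal_invariant_poly => [g|i].
  rewrite /p map_polyZ rmorphXn /= rmorph_int; congr (_ *: _).
  rewrite [RHS](reindex_inj (imset_inj (@act_inj g))) rmorph_prod /=.
  apply: eq_big => [B|B _]; first by rewrite blocks_act.
  by rewrite map_polyXsubC block_prod_act rmorphXn.
rewrite /p -big_enum -(big_map (fun B => block_prod B ^+ m) xpredT (fun x => 'X - x%:P)) /=.
apply: integral_scale_prodXsubC => t /subseqP[mk _ ->]; rewrite -map_mask big_map.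
set bs := mask mk _; rewrite prodrXl -exprMn.
apply: integral_exp.
have [cs Dcs] : {cs | perm_eq (enum blocks) (bs ++ cs)}.
  by apply: perm_to_subseq; apply: mask_subseq.
have -> : \prod_(B <- bs) block_prod B =
    \prod_(x <- flatten [seq [seq val u | u <- enum (B : {set T})] | B <- bs]) x.
  rewrite big_flatten big_map; apply: eq_bigr => B _.
  by rewrite big_map big_enum.
apply: (integral_subprod (t := flatten [seq [seq val u | u <- enum (B : {set T})] | B <- cs])).
move=> j; rewrite -flatten_cat -map_cat.
rewrite -(perm_big _ (perm_flatten (perm_map _ Dcs))).
rewrite -(perm_big _ roots_blocks) -Df coef_map.
exact: integral_id.
Qed.

End Roots.
End Fixer.
End Blocks.

(** * Roots of irreducible polynomials in a Galois extension *)

Lemma irreducible_dvdp_root (F K : fieldType) (iota : {rmorphism F -> K})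
    (p q : {poly F}) (x : K) :
  irreducible_poly p -> root (map_poly iota p) x -> root (map_poly iota q) x -> p %| q.
Proof.
(* Otherwise [p] and [q] are coprime, also over [K], and have no common root. *)
move=> irr_p px; apply: contraLR; rewrite -irreducible_poly_coprime //.
by rewrite -(coprimep_map iota) => /coprimep_root/(_ px).
Qed.

(** In characteristic zero the derivative is non-zero and of smaller degree, hence prime to [p]. *)
Lemma irreducible_separable (p : {poly rat}) : irreducible_poly p -> separable_poly p.
Proof.
move=> irr_p; have sz_p := irr_p.1; rewrite unlock irreducible_poly_coprime //.
have nz_p : p != 0 by rewrite -size_poly_gt0 ltnW.
have nz_dp : p^`() != 0.
  apply: contraTneq sz_p => dp0; have := congr1 (fun r : {poly rat} => r`_(size p).-2) dp0.
  rewrite coef_deriv coef0; case: (size p) (lead_coefE p) => [|[|n]] //= <- /eqP.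
  by rewrite mulrn_eq0 lead_coef_eq0 (negPf nz_p).
by apply/negP => /(dvdp_leq nz_dp); rewrite leqNgt lt_size_deriv.
Qed.

(** As a divisor of [q], [p] splits over [L]. The minimal polynomial of a root x over Q is [p] up to
    a constant, so every other root is a conjugate of x. *)
Lemma irreducible_galois_roots (L : splittingFieldType rat) (p q : {poly rat})
    (ss : seq L) :
    galois 1 {:L} -> irreducible_poly p -> p %| q -> q != 0 ->
    map_poly (in_alg L) q = in_alg L (lead_coef q) *: \prod_(x <- ss) ('X - x%:P) ->
  exists rs, [/\ uniq rs,
    map_poly (in_alg L) p = in_alg L (lead_coef p) *: \prod_(x <- rs) ('X - x%:P) &
    {in rs &, forall x y, exists g : gal_of {:L}, g x = y}].
Proof.
move=> galL irr_p dv_p_q nz_q Dq.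
have sz_p := irr_p.1; have nz_p : p != 0 by rewrite -size_poly_gt0 ltnW.
have : map_poly (in_alg L) p %| \prod_(x <- ss) ('X - x%:P).
  rewrite -(@dvdpZr _ (in_alg L (lead_coef q))) ?fmorph_eq0 ?lead_coef_eq0 //.
  by rewrite -Dq dvdp_map.
case/dvdp_prod_XsubC => m; set rs := mask m ss => eq_p.
have Dp : map_poly (in_alg L) p = in_alg L (lead_coef p) *: \prod_(x <- rs) ('X - x%:P).
  have := eqp_eq eq_p; rewrite lead_coef_map.
  by rewrite (monicP (monic_prod_XsubC _ _ _)) scale1r.
exists rs; split=> //.
  rewrite -separable_prod_XsubC -(eqp_separable eq_p) separable_map.
  exact: irreducible_separable.
have root_rs x : x \in rs -> root (map_poly (in_alg L) p) x.
  by rewrite (eqp_root eq_p) root_prod_XsubC.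
move=> x y /root_rs px /root_rs py.
have /polyOver1P[r Dr] := minPolyOver 1%AS x.
have sz_r : size r != 1%N.
  rewrite -(size_map_poly (in_alg L)) -Dr gtn_eqF //.
  by apply: (root_size_gt1 _ (root_minPoly _ x)); rewrite monic_neq0 ?monic_minPoly.
have p1 : map_poly (in_alg L) p \is a polyOver 1%AS by apply/polyOver1P; exists p.
have := minPoly_dvdp p1 px; rewrite Dr dvdp_map => /(irr_p.2 _ sz_r) eq_rp.
have [|g _ <-] := normalField_root_minPoly (sub1v _) (normalFieldf 1%AS) (memvf x) (b := y).
  by rewrite Dr (eqp_root (q := map_poly (in_alg L) p)) // eqp_map.
by exists g.
Qed.

(** * Factorizations of an algebraic number and orbits of conjugates *)

Section Decomposition.
Variable C : numClosedFieldType.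
Local Notation algebraic := (algebraicOver (ratr : rat -> C)).
Local Notation ZC := (map_poly (intr : int -> C)).
Local Notation ZQ := (map_poly (intr : int -> rat)).

(** [bs] groups the roots of [f] into blocks. Together with the norm map, this is what the estimates
    below retain of the Galois action. *)
Definition block_datum (f : {poly int}) (D : nat) (bs : seq (seq C)) :=
  [/\ ZC f = (lead_coef f)%:~R *: \prod_(z <- flatten bs) ('X - z%:P),
      (size bs <= D)%N &
      forall m, exists q : {poly int},
        ZC q = (lead_coef f)%:~R ^+ m *: \prod_(b <- bs) ('X - ((\prod_(z <- b) z) ^+ m)%:P)].

(* [nu] is the norm map from a large Galois extension to the normal closure of Q(a),
   [n] its degree, and [bs] lists the orbits of the roots of [f] under the relative
   Galois group; their number is bounded independently of the factorization [us]. *)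
Lemma block_decomposition (a : C) : algebraic a -> exists D : nat,
  forall us : seq C, (forall u, u \in us -> algebraic u) -> \prod_(u <- us) u = a ->
  exists n (nu : C -> C), [/\ (0 < n)%N, a ^+ n = \prod_(u <- us) nu u &
    forall u f, u \in us -> irreducible_poly (ZQ f) -> root (ZC f) u ->
      exists bs, block_datum f D bs /\
        exists2 b, b \in bs & (0 < size b)%N /\ (\prod_(z <- b) z) ^+ n = nu u ^+ size b].
Proof.
move=> alg_a; have [p0 [nz_p0 p0a irr_p0]] := irreducible_root alg_a.
(* [k] is the degree of [a], and [k ^ k] counts the self-maps of its set of conjugates. *)
pose k := (size p0).-1; exists (k ^ k)%N => us alg_us prod_us.
(* As [q] vanishes at [a] and at every factor, its splitting field contains all their conjugates. *)
have [q [nz_q dv_p0q q_us]] : exists q : {poly rat}, [/\ q != 0, p0 %| q &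
    forall u, u \in us -> root (map_poly ratr q) u].
  elim: (us) alg_us => [|u vs IHvs] alg_vs; first by exists p0; rewrite dvdpp.
  have [|q [nz_q dv_q q_vs]] := IHvs.
    by move=> v vs_v; apply: alg_vs; rewrite inE vs_v orbT.
  have [p [nz_p pu _]] := irreducible_root (alg_vs u (mem_head _ _)).
  exists (p * q); split; rewrite ?mulf_neq0 ?dvdp_mull //.
  by move=> v; rewrite inE rmorphM rootM => /predU1P[->|/q_vs ->]; rewrite ?pu ?orbT.
have [L [iota [ss [galL Dq]]]] := galois_closure_exists C nz_q.
have map_iota (p : {poly rat}) : map_poly iota (map_poly (in_alg L) p) = map_poly ratr p.
  rewrite -map_poly_comp; apply: eq_map_poly => b /=.
  by rewrite alg_num_field fmorph_rat.
have iota_surj u : u \in us -> exists x, iota x = u.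
  move=> /q_us; rewrite -map_iota Dq map_polyZ rootZ ?fmorph_eq0 ?lead_coef_eq0 //.
  rewrite rmorph_prod /=; under eq_bigr do rewrite map_polyXsubC.
  rewrite -(big_map iota xpredT (fun y => 'X - y%:P)) root_prod_XsubC.
  by case/mapP=> x _ ->; exists x.
have /choice[kap Dkap] : forall v, exists x : L, v \in us -> iota x = v.
  by move=> v; have [/iota_surj[x]|] := boolP (v \in us); [exists x | exists 0].
have [ws [uniq_ws Dws _]] := irreducible_galois_roots galL irr_p0 dv_p0q nz_q Dq.
have mem_ws x : (x \in ws) = root (map_poly (in_alg L) p0) x.
  by rewrite Dws rootZ ?fmorph_eq0 ?lead_coef_eq0 // root_prod_XsubC.
have sz_ws : size ws = k.
  rewrite /k -(size_map_poly (in_alg L)) Dws size_scale ?fmorph_eq0 ?lead_coef_eq0 //.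
  by rewrite size_prod_XsubC.
have gal_ws (g : gal_of {:L}) x : x \in ws -> g x \in ws.
  rewrite !mem_ws; have -> : map_poly (in_alg L) p0 = map_poly g (map_poly (in_alg L) p0).
    by rewrite -map_poly_comp; apply: eq_map_poly => b; rewrite /= linearZ /= rmorph1.
  rewrite fmorph_root -map_poly_comp.
  by rewrite (eq_map_poly (g := in_alg L)) // => b; rewrite /= linearZ /= rmorph1.
pose n := #|fixer ws|; pose nu u := iota (fixer_norm ws (kap u)).
have Da : a = iota (\prod_(u <- us) kap u).
  by rewrite rmorph_prod -prod_us; apply: eq_big_seq => u /Dkap.
exists n, nu; split.
- exact: (@cardG_gt0 _ (fixer_group ws)).
(* The preimage of [a] is a root of [p0], so [fixer ws] fixes it and the product of its images is
   its [n]-th power. *)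
- rewrite /nu -rmorph_prod /fixer_norm exchange_big /=.
  under eq_bigr do rewrite -rmorph_prod.
  rewrite {1}Da -rmorphXn -prodr_const; congr (iota _).
  apply: eq_bigr => h /fixerP Hh; rewrite /= Hh //.
  by rewrite mem_ws -(fmorph_root iota) map_iota -Da.
move=> u f us_u irr_f fu.
have map_int (K : fieldType) (g : {rmorphism rat -> K}) (p : {poly int}) :
    map_poly g (ZQ p) = map_poly intr p.
  by rewrite -map_poly_comp; apply: eq_map_poly => b; rewrite /= rmorph_int.
have map_iotaZ (p : {poly int}) : map_poly iota (map_poly intr p) = ZC p.
  by rewrite -map_poly_comp; apply: eq_map_poly => b; rewrite /= rmorph_int.
have dv_fq : ZQ f %| q.
  apply: (irreducible_dvdp_root irr_f (iota := ratr : {rmorphism rat -> C})) (q_us u us_u).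
  by rewrite map_int.
have [rs [uniq_rs Drs trans_rs]] := irreducible_galois_roots galL irr_f dv_fq nz_q Dq.
rewrite map_int lead_coef_map_inj ?rmorph0 //= in Drs; last exact: intr_inj.
rewrite -in_algE rmorph_int in Drs.
have nz_f : f != 0 by apply: contraTneq irr_f.1 => ->; rewrite rmorph0 size_poly0.
pose Bs := enum (blocks ws rs).
pose bs := [seq [seq iota (val x) | x <- enum (B : {set seq_sub rs})] | B <- Bs].
have prod_bs B : \prod_(z <- [seq iota (val x) | x <- enum (B : {set seq_sub rs})]) z
    = iota (block_prod B).
  by rewrite big_map big_enum rmorph_prod.
exists bs; split.
  split.
  - rewrite -map_iotaZ Drs linearZ /= rmorph_int rmorph_prod; congr (_ *: _).
    rewrite (perm_big _ (roots_blocks ws uniq_rs Drs nz_f)) /=.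
    rewrite !big_flatten !big_map; apply: eq_bigr => B _.
    by rewrite !big_map; apply: eq_bigr => x _; rewrite map_polyXsubC.
  - by rewrite size_map -cardE -sz_ws; apply: (card_blocks gal_ws Drs nz_f trans_rs).
  move=> m; have [g Dg] := blocks_poly galL gal_ws uniq_rs Drs nz_f m.
  exists g; rewrite -map_iotaZ Dg linearZ /= rmorphXn rmorph_int; congr (_ *: _).
  rewrite rmorph_prod big_map big_enum; apply: eq_bigr => B _ /=.
  by rewrite map_polyXsubC rmorphXn prod_bs.
have rs_u : kap u \in rs.
  rewrite (mem_roots Drs nz_f) -(fmorph_root iota) map_iotaZ Dkap //.
pose B := orb ws (SeqSub rs_u).
exists [seq iota (val x) | x <- enum B].
  by apply: map_f; rewrite mem_enum; apply/mem_blocks; exists (SeqSub rs_u).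
rewrite size_map -cardE; split.
  by apply/card_gt0P; exists (SeqSub rs_u); apply: (orb_id _ Drs nz_f).
rewrite prod_bs /nu -!rmorphXn; congr (iota _).
exact: (block_prod_norm gal_ws Drs nz_f).
Qed.
End Decomposition.

From mathcomp Require Import zify lra finmap complex.
From mathcomp Require Import all_classical all_reals all_analysis.

Local Open Scope classical_set_scope.
Local Open Scope complex_scope.

(** * Mahler measure of integer polynomials *)

Section Cnorm.
Variable R : realType.
Implicit Types (z w : R[i]) (t : R).

Lemma cnormE z : `|z| = (cnorm z)%:C.
Proof. by case: z. Qed.

Lemma cnorm_ge0 z : 0 <= cnorm z.
Proof. by have := normr_ge0 z; rewrite cnormE ler0c. Qed.

Lemma cnormM z w : cnorm (z * w) = cnorm z * cnorm w.
Proof. by rewrite /cnorm normrM !cnormE -rmorphM. Qed.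

Lemma cnorm1 : cnorm (1 : R[i]) = 1.
Proof. by rewrite /cnorm normr1. Qed.

Lemma cnormX z n : cnorm (z ^+ n) = cnorm z ^+ n.
Proof. by elim: n => [|n IHn]; rewrite ?expr0 ?cnorm1 // !exprS cnormM IHn. Qed.

Lemma cnorm_eq0 z : (cnorm z == 0) = (z == 0).
Proof. by rewrite -[RHS]normr_eq0 cnormE (inj_eq (@complexI R) _ 0). Qed.

Lemma cnorm0 : cnorm (0 : R[i]) = 0.
Proof. by apply/eqP; rewrite cnorm_eq0. Qed.

Lemma cnorm_gt0 z : (0 < cnorm z) = (z != 0).
Proof. by rewrite lt0r cnorm_eq0 cnorm_ge0 andbT. Qed.

Lemma cnormV z : cnorm z^-1 = (cnorm z)^-1.
Proof. by rewrite /cnorm normfV cnormE -fmorphV. Qed.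

Lemma cnormN z : cnorm (- z) = cnorm z.
Proof. by rewrite /cnorm normrN. Qed.

Lemma cnormD z w : cnorm (z + w) <= cnorm z + cnorm w.
Proof. by have := ler_normD z w; rewrite !cnormE -rmorphD lecR. Qed.

Lemma cnorm_int (n : int) : cnorm (n%:~R : R[i]) = `|n|%:~R.
Proof. by rewrite /cnorm -intr_norm -(rmorph_int (real_complex R)). Qed.

Lemma logp_ge0 t : 0 <= logp t.
Proof. by rewrite /logp le_max lexx orbT. Qed.

Lemma ln_le_logp t : ln t <= logp t.
Proof. by rewrite /logp le_max lexx. Qed.

Lemma logp_le1 t : t <= 1 -> logp t = 0.
Proof. by move=> t1; apply/max_idPr; apply: ln_le0. Qed.

Lemma logpM (s t : R) : 0 <= s -> 0 <= t -> logp (s * t) <= logp s + logp t.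
Proof.
rewrite le_eqVlt => /predU1P[<-|s0].
  by rewrite mul0r logp_le1 ?ler01 // addr_ge0 ?logp_ge0.
rewrite le_eqVlt => /predU1P[<-|t0].
  by rewrite mulr0 [logp 0]logp_le1 ?ler01 // addr_ge0 ?logp_ge0.
rewrite {1}/logp ge_max addr_ge0 ?logp_ge0 // andbT lnM ?posrE //.
by rewrite lerD ?ln_le_logp.
Qed.

Lemma logp_prod (s : seq R[i]) :
  logp (cnorm (\prod_(z <- s) z)) <= \sum_(z <- s) logp (cnorm z).
Proof.
elim: s => [|z s IHs]; first by rewrite !big_nil cnorm1 logp_le1.
rewrite !big_cons cnormM (le_trans (logpM _ _)) ?cnorm_ge0 //.
by rewrite lerD2l.
Qed.

Lemma logpX t n : 0 <= t -> logp (t ^+ n) = logp t *+ n.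
Proof.
rewrite le_eqVlt => /predU1P[<-|t0].
  by rewrite [logp 0]logp_le1 // mul0rn logp_le1 // expr0n; case: n.
rewrite /logp lnXn //; have [t1|/ltW t1] := leP 0 (ln t).
  by rewrite !max_l ?mulrn_wge0.
by rewrite !max_r ?mul0rn ?mulrn_wle0.
Qed.

Lemma logpV t : 0 < t -> logp t^-1 = logp t - ln t.
Proof.
move=> t0; by rewrite /logp lnV ?posrE // addr_maxl subrr sub0r maxC.
Qed.

(** Both 1 and t are at most exp(log+ t). This controls the factors 1 + |y|^m in the coefficient
    bound. *)
Lemma le_expR_logp t : 0 <= t -> 1 + t <= 2 * expR (logp t).
Proof.
move=> t0; have e1 : 1 <= expR (logp t) by rewrite -expR0 ler_expR logp_ge0.
have : t <= expR (logp t).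
  move: t0; rewrite le_eqVlt => /predU1P[<-|t0]; first exact: expR_ge0.
  by rewrite -{1}[t]lnK ?posrE // ler_expR ln_le_logp.
by rewrite mulr2n mulrDl mul1r => ?; apply: lerD.
Qed.

End Cnorm.

Section Reversal.
Variable K : comNzRingType.

(** X^n p(1/X) when [p] has degree at most [n]; keeping [n] separate from [p] makes the operation
    linear. *)
Definition reverse_poly (n : nat) (p : {poly K}) := \poly_(i < n.+1) p`_(n - i).

Lemma reverse_polyZ n c (p : {poly K}) : reverse_poly n (c *: p) = c *: reverse_poly n p.
Proof.
apply/polyP => i; rewrite coefZ !coef_poly coefZ.
by case: ifP => // _; rewrite mulr0.
Qed.

Lemma reverse_prodXsubC (s : seq K) :
  reverse_poly (size s) (\prod_(z <- s) ('X - z%:P)) = \prod_(z <- s) (1 - z *: 'X).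
Proof.
elim: s => [|z s IHs].
  by rewrite !big_nil; apply/polyP => i; rewrite coef_poly !coef1; case: i.
rewrite !big_cons -IHs; set p := \prod_(_ <- s) _; apply/polyP => i.
have sz_p : size p = (size s).+1 by rewrite /p size_prod_XsubC.
rewrite [in RHS]mulrBl mul1r -[in RHS]scalerAl [in RHS]coefB coefZ coefXM.
rewrite !coef_poly /= mulrBl coefB coefXM coefCM.
case: i => [|i] /=.
  by rewrite !subn0 /= [p`_(size s).+1]nth_default ?sz_p // !mulr0.
rewrite !ltnS subSS; have [lt_is|] := ltnP i (size s).
  by rewrite ltnW // subn_eq0 leqNgt lt_is /= subnS.
rewrite leq_eqVlt => /predU1P[<-|lt_si]; first by rewrite leqnn subnn eqxx.
by rewrite leqNgt lt_si mulr0 subrr.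
Qed.

End Reversal.

Section MahlerPoly.
Variable R : realType.
Local Notation C := R[i].
Local Notation ZC := (map_poly (intr : int -> C)).
Local Notation ZQ := (map_poly (intr : int -> rat)).

(** The roots are determined up to order, so any factorization may replace the chosen [croots]. *)
Lemma mahler_polyE (c : C) (s : seq C) : c != 0 ->
  mahler_poly (c *: \prod_(z <- s) ('X - z%:P)) =
    ln (cnorm c) + \sum_(z <- s) logp (cnorm z).
Proof.
move=> nz_c; set f := _ *: _.
have Dc : lead_coef f = c.
  by rewrite lead_coefZ (monicP (monic_prod_XsubC _ _ _)) mulr1.
have Df : f = lead_coef f *: \prod_(z <- croots f) ('X - z%:P).
  exact: svalP (closed_field_poly_normal f).
rewrite /mahler_poly Dc; congr (_ + _); apply: perm_big.
apply: prod_XsubC_eq; apply: (scalerI nz_c).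
by rewrite -{1}Dc -Df.
Qed.

Lemma poly_splits (f : {poly C}) :
  exists s : seq C, f = lead_coef f *: \prod_(z <- s) ('X - z%:P).
Proof. by have [s Df] := closed_field_poly_normal f; exists s. Qed.

Lemma mahler_polyM (f g : {poly C}) : f != 0 -> g != 0 ->
  mahler_poly (f * g) = mahler_poly f + mahler_poly g.
Proof.
rewrite -!lead_coef_eq0; have [s Df] := poly_splits f; have [t Dg] := poly_splits g.
move=> f0 g0; rewrite [in LHS]Df [in LHS]Dg -scalerAl -scalerAr scalerA -big_cat /=.
rewrite mahler_polyE ?mulf_neq0 // [in RHS]Df [in RHS]Dg !mahler_polyE //.
by rewrite cnormM lnM ?posrE ?cnorm_gt0 // big_cat /= addrACA.
Qed.

Lemma ZC_eq0 (p : {poly int}) : (ZC p == 0) = (p == 0).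
Proof. by rewrite -!size_poly_eq0 size_map_inj_poly ?rmorph0 //; apply: intr_inj. Qed.

Lemma lead_coef_ZC (p : {poly int}) : lead_coef (ZC p) = (lead_coef p)%:~R.
Proof. by rewrite lead_coef_map_inj //; apply: intr_inj. Qed.

(** The leading coefficient is a non-zero integer, so its logarithm is nonnegative. *)
Lemma mahler_poly_int_ge0 (p : {poly int}) : p != 0 -> 0 <= mahler_poly (ZC p).
Proof.
move=> nz_p; have [s ->] := poly_splits (ZC p).
rewrite lead_coef_ZC mahler_polyE ?intr_eq0 ?lead_coef_eq0 //.
apply: addr_ge0; last by apply: sumr_ge0 => z _; apply: logp_ge0.
apply: ln_ge0; rewrite cnorm_int -[1]/(1%:~R) ler_int.
by rewrite -gtz0_ge1 normr_gt0 lead_coef_eq0.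
Qed.

Lemma ratr_ZQ (p : {poly int}) : map_poly ratr (ZQ p) = ZC p.
Proof. by rewrite -map_poly_comp; apply: eq_map_poly => n; rewrite /= ratr_int. Qed.

(** Clear denominators in an irreducible rational polynomial and take the primitive part. Thus the
    default 0 in [minpolyZ] is never taken. *)
Lemma is_minpolyZ_ex (a : Qbarx R) : exists p, is_minpolyZ a p.
Proof.
have [_ /asboolP alg_a] := andP (valP a).
have [p [nz_p pa irr_p]] := irreducible_root alg_a.
have [q [d nz_d Dp]] := rat_poly_scale p.
have nz_q : q != 0 by apply: contraNneq nz_p => q0; rewrite Dp q0 rmorph0 scaler0.
have eq_p : ZQ (zprimitive q) %= p.
  rewrite Dp [in X in _ %= X](zpolyEprim q) map_polyZ scalerA eqp_sym.
  by rewrite eqp_scale // mulf_neq0 ?invr_eq0 ?intr_eq0 ?zcontents_eq0.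
exists (zprimitive q); split.
- split=> [|r sz_r]; first by rewrite (eqp_size eq_p) irr_p.1.
  rewrite (eqp_dvdr _ eq_p) => /(irr_p.2 r sz_r) eq_r.
  by apply: eqp_trans eq_r _; rewrite eqp_sym.
- by rewrite zcontents_primitive nz_q.
rewrite -ratr_ZQ -(eqp_root (p := map_poly ratr p)) //.
by rewrite eqp_map eqp_sym.
Qed.

Lemma minpolyZP (a : Qbarx R) : is_minpolyZ a (minpolyZ a).
Proof. exact: (xgetPex 0 (is_minpolyZ_ex a)). Qed.

Lemma minpolyZ_neq0 (a : Qbarx R) : minpolyZ a != 0.
Proof.
have [irr_p _ _] := minpolyZP a.
by apply: contraTneq irr_p.1 => ->; rewrite rmorph0 size_poly0.
Qed.

Lemma mahler_ge0 (a : Qbarx R) : 0 <= mahler a.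
Proof. exact: mahler_poly_int_ge0 (minpolyZ_neq0 a). Qed.

(** By Gauss's lemma the minimal polynomial divides [q] over the integers, and the cofactor has
    nonnegative measure. This is the source of the upper bounds for [mahler] below. *)
Lemma mahler_le_root (a : Qbarx R) (q : {poly int}) :
  q != 0 -> root (ZC q) (val a) -> mahler a <= mahler_poly (ZC q).
Proof.
move=> nz_q qa; have [irr_p prim_p pa] := minpolyZP a.
rewrite /mahler; set p := minpolyZ a in irr_p prim_p pa *.
have : ZQ p %| ZQ q.
  apply: (irreducible_dvdp_root irr_p (iota := ratr : {rmorphism rat -> C}) (x := val a)).
    by rewrite ratr_ZQ.
  by rewrite ratr_ZQ.
rewrite dvdp_rat_int => /dvdpP_int[r Dq].
have {}Dq : q = p * r by rewrite Dq [in RHS](zpolyEprim p) prim_p scale1r.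
have [nz_p nz_r] : p != 0 /\ r != 0 by apply/norP; rewrite -mulf_eq0 -Dq.
rewrite Dq rmorphM mahler_polyM ?ZC_eq0 //.
by rewrite lerDl mahler_poly_int_ge0.
Qed.


Lemma val_QbarxX (a : Qbarx R) n : val (a ^+ n)%g = val a ^+ n.
Proof. by elim: n => [|n IHn] //; rewrite expgS exprS /= -IHn. Qed.

Lemma Qbarx_neq0 (a : Qbarx R) : val a != 0.
Proof. by case/andP: (valP a). Qed.

Lemma mahler_poly_le1 (c : C) (s : seq C) :
  cnorm c = 1 -> (forall z, z \in s -> cnorm z <= 1) ->
  mahler_poly (c *: \prod_(z <- s) ('X - z%:P)) = 0.
Proof.
move=> c1 s1; rewrite mahler_polyE -?cnorm_eq0 c1 ?oner_eq0 // ln1 add0r.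
by apply: big1_seq => z /s1 z1; apply: logp_le1.
Qed.

Lemma expr_cnorm1 (z : C) n : (0 < n)%N -> z ^+ n = 1 -> cnorm z = 1.
Proof.
move=> n_gt0 zn1; apply/eqP; rewrite -(@pexpr_eq1 _ _ n) ?cnorm_ge0 //.
by rewrite -cnormX zn1 cnorm1.
Qed.

(** X^n - 1 is monic with all its roots on the unit circle. *)
Lemma mahler_Tor (z : Qbarx R) : @Tor R z -> mahler z = 0.
Proof.
case=> n n_gt0 zn1; apply/le_anti; rewrite mahler_ge0 andbT.
have val_zn : val z ^+ n = 1 by rewrite -val_QbarxX zn1.
have nz_p : 'X^n - 1 != 0 :> {poly int} by rewrite -size_poly_gt0 size_XnsubC.
apply: le_trans (mahler_le_root nz_p _) _.
  by rewrite rmorphB rmorph1 /= map_polyXn /root !hornerE val_zn subrr.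
rewrite rmorphB rmorph1 /= map_polyXn.
have [s Ds] := poly_splits ('X^n - 1 : {poly C}).
rewrite (monicP (monicXnsubC _ n_gt0)) in Ds.
rewrite Ds mahler_poly_le1 ?cnorm1 // => y.
rewrite -root_prod_XsubC -[X in root X]scale1r -Ds => /unity_rootP/expr_cnorm1 -> //.
Qed.

Lemma sub1_neq0 (z : C) : 1 - z *: 'X != 0 :> {poly C}.
Proof.
apply/eqP => /(congr1 (fun p : {poly C} => p`_0)).
by rewrite coefB coef1 coefZ coefX mulr0 subr0 coef0 => /eqP; rewrite oner_eq0.
Qed.

(** For z non-zero, 1 - z X has leading coefficient -z and root 1/z, and log|z| + log+(1/|z|) =
    log+|z|. For z = 0 it is the constant 1. *)
Lemma mahler_poly_prod_sub1 (c : C) (s : seq C) : c != 0 ->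
  mahler_poly (c *: \prod_(z <- s) (1 - z *: 'X)) =
  mahler_poly (c *: \prod_(z <- s) ('X - z%:P)).
Proof.
move=> nz_c; rewrite [RHS]mahler_polyE //.
have sub1E (z : C) : 1 - z *: 'X =
    (if z == 0 then 1 else - z) *: \prod_(w <- if z == 0 then [::] else [:: z^-1]) ('X - w%:P).
  case: eqP => [->|/eqP nz_z]; first by rewrite scale0r subr0 big_nil scale1r.
  have {1}<- : z *: (z^-1)%:P = 1 by rewrite -mul_polyC -polyCM divff.
  by rewrite big_seq1 scaleNr scalerBr opprB.
have M_sub1 (z : C) : mahler_poly (1 - z *: 'X) = logp (cnorm z).
  rewrite sub1E; case: eqP => [->|/eqP nz_z].
    by rewrite mahler_polyE ?oner_eq0 // big_nil cnorm1 ln1 addr0 cnorm0 logp_le1 ?ler01.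
  rewrite mahler_polyE ?oppr_eq0 // big_seq1 cnormN cnormV logpV ?cnorm_gt0 //.
  by rewrite addrC subrK.
elim: s => [|z s IHs].
  by have := mahler_polyE [::] nz_c; rewrite !big_nil.
have nz_prod : c *: \prod_(w <- s) (1 - w *: 'X) != 0.
  rewrite scaler_eq0 negb_or nz_c /= prodf_seq_neq0.
  by apply/allP => w _; apply: sub1_neq0.
rewrite !big_cons scalerAr.
rewrite (mahler_polyM (sub1_neq0 z) nz_prod) M_sub1 IHs.
by rewrite addrCA.
Qed.

(** The reversed minimal polynomial of [a] has 1/a as a root and the same Mahler measure. *)
Lemma mahlerV_le (a : Qbarx R) : mahler a^-1%g <= mahler a.
Proof.
have [_ _ pa] := minpolyZP a; have nz_p := minpolyZ_neq0 a.
rewrite [leRHS]/mahler; set p := minpolyZ a in pa nz_p *.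
have [s Ds] := poly_splits (ZC p).
have nz_c : lead_coef (ZC p) != 0 by rewrite lead_coef_eq0 ZC_eq0.
pose q := reverse_poly (size s) p.
have Dq : ZC q = lead_coef (ZC p) *: \prod_(z <- s) (1 - z *: 'X).
  rewrite -reverse_prodXsubC -reverse_polyZ -Ds; apply/polyP => i.
  rewrite coef_map [q`_i]coef_poly [RHS]coef_poly coef_map.
  by case: ifP; rewrite ?rmorph0.
rewrite Ds -mahler_poly_prod_sub1 // -Dq; apply: mahler_le_root.
  rewrite -ZC_eq0 Dq scaler_eq0 negb_or nz_c /= prodf_seq_neq0.
  by apply/allP => w _; apply: sub1_neq0.
have sa : val a \in s.
  by move: pa; rewrite Ds rootZ // root_prod_XsubC.
rewrite Dq rootZ // (big_rem _ sa) rootM rootE !hornerE /=.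
by rewrite mulfV ?Qbarx_neq0 // subrr eqxx.
Qed.

Lemma mahlerV (a : Qbarx R) : mahler a^-1%g = mahler a.
Proof.
by apply/le_anti; rewrite mahlerV_le -{1}[a]invgK mahlerV_le.
Qed.

End MahlerPoly.

(** * A gap for small Mahler measures in bounded degree *)

Section Torsion.
Variable F : fieldType.
Implicit Types (x y : F) (ys : seq F).

Lemma expr_eq_torsion y m n : y != 0 -> m != n -> y ^+ m = y ^+ n ->
  exists2 k, (0 < k)%N & y ^+ k = 1.
Proof.
move=> nz_y; wlog lt_mn : m n / (m < n)%N => [W neq_mn eq_y|_ eq_y].
  have := neq_mn; rewrite neq_ltn => /orP[lt_mn|lt_nm]; first exact: (W m n).
  by apply: (W n m); rewrite // eq_sym.
exists (n - m)%N; first by rewrite subn_gt0.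
apply: (mulIf (expf_neq0 m nz_y)).
by rewrite mul1r -exprD subnK ?eq_y // ltnW.
Qed.

(** Choose a self-map tau of [ys] with x^i = tau(x)^j; its k-th iterate y of x satisfies x^(i^k) =
    y^(j^k). As [ys] is finite, some iterate y is periodic, which gives y^(i^k) = y^(j^k) for some k
    > 0. So y is a root of unity, and hence x is one too. *)
Lemma power_map_torsion ys i j : (0 < i)%N -> (0 < j)%N -> i != j ->
    (forall x, x \in ys -> exists2 y, y \in ys & x ^+ i = y ^+ j) ->
  forall x, x \in ys -> x != 0 -> exists2 k, (0 < k)%N & x ^+ k = 1.
Proof.
move=> i_gt0 j_gt0 neq_ij map_ys.
have /choice[tau Dtau] : forall x, exists y, x \in ys -> y \in ys /\ x ^+ i = y ^+ j.
  by move=> x; have [/map_ys[y ys_y eq_xy]|] := boolP (x \in ys); [exists y|exists 0].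
have tau_iter x k : x \in ys -> iter k tau x \in ys /\ x ^+ (i ^ k) = iter k tau x ^+ (j ^ k).
  move=> ys_x; elim: k => [|k [ys_k eq_k]] //=.
  have [ys_Sk eq_Sk] := Dtau _ ys_k; split=> //.
  by rewrite expnSr exprM eq_k exprAC eq_Sk expnS exprM.
move=> x ys_x nz_x.
have /(uniqPn 0)[a [b [lt_ab]]] : ~~ uniq [seq iter k tau x | k <- iota 0 (size ys).+1].
  apply/negP => uniq_s.
  have sub_s : {subset [seq iter k tau x | k <- iota 0 (size ys).+1] <= ys}.
    by move=> _ /mapP[k _ ->]; have [] := tau_iter x k ys_x.
  by have := uniq_leq_size uniq_s sub_s; rewrite size_map size_iota ltnn.
rewrite size_map size_iota => lt_b; have lt_a := ltn_trans lt_ab lt_b.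
rewrite !(nth_map 0%N) ?size_iota // !nth_iota // !add0n.
have [ys_y eq_y] := tau_iter x a ys_x; set y := iter a tau x in ys_y eq_y *.
rewrite -(subnK (ltnW lt_ab)) iterD -/y => eq_ab.
have nz_y : y != 0.
  apply: contraNneq nz_x => y0; move/eqP: eq_y.
  by rewrite y0 expr0n expn_eq0 !eqn0Ngt j_gt0 /= expf_eq0 => /andP[].
have [_ eq_k] := tau_iter y (b - a)%N ys_y; rewrite -eq_ab in eq_k.
have [|n n_gt0 yn1] := expr_eq_torsion nz_y _ eq_k.
  by rewrite eqn_exp2r // subn_gt0.
exists (i ^ a * n)%N; first by rewrite muln_gt0 expn_gt0 i_gt0.
by rewrite exprM eq_y exprAC yn1 expr1n.
Qed.
End Torsion.

Section Kronecker.
Variable R : realType.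
Local Notation C := R[i].
Local Notation ZC := (map_poly (intr : int -> C)).

Lemma cnorm_coef_prod (ys : seq C) i :
  cnorm (\prod_(y <- ys) ('X - y%:P))`_i <= \prod_(y <- ys) (1 + cnorm y).
Proof.
elim: ys i => [|y ys IHys] i.
  by rewrite !big_nil coef1; case: (_ == _); rewrite ?cnorm1 ?cnorm0 ?ler01.
rewrite !big_cons mulrBl coefB coefXM coefCM (le_trans (cnormD _ _)) //.
rewrite cnormN cnormM mulrDl mul1r lerD ?ler_wpM2l ?cnorm_ge0 //.
case: ifP => _ //; rewrite cnorm0 big_seq prodr_ge0 // => z _.
by rewrite addr_ge0 ?ler01 ?cnorm_ge0.
Qed.

(** Each root contributes at most 1 + |y|^m <= 2 exp(m log+|y|). *)
Lemma cnorm_coef_le (l : int) (ys : seq C) m i : l != 0 ->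
  cnorm ((l%:~R ^+ m *: \prod_(y <- ys) ('X - (y ^+ m)%:P))`_i) <=
  2 ^+ size ys * expR ((ln (cnorm (l%:~R : C)) + \sum_(y <- ys) logp (cnorm y)) *+ m).
Proof.
move=> nz_l; rewrite coefZ cnormM cnormX.
rewrite mulrnDl expRD mulrCA; apply: ler_pM; rewrite ?exprn_ge0 ?cnorm_ge0 //.
  by rewrite -mulr_natr expRM_natr lnK // posrE cnorm_gt0 intr_eq0.
have := cnorm_coef_prod [seq y ^+ m | y <- ys] i; rewrite !big_map => /le_trans; apply.
elim: ys => [|y ys IHys]; first by rewrite !big_nil mul0rn expR0 mulr1.
rewrite !big_cons mulrnDl expRD exprS mulrACA ler_pM ?addr_ge0 ?ler01 ?cnorm_ge0 //.
  by rewrite big_seq prodr_ge0 // => z _; rewrite addr_ge0 ?ler01 ?cnorm_ge0.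
by rewrite -logpX ?cnorm_ge0 // -cnormX le_expR_logp ?cnorm_ge0.
Qed.

(* The polynomials for 0 < m <= #|T| + 1 have bounded coefficients, so two of them
   coincide, and then the i-th powers of the [ys] are a permutation of the j-th
   powers. *)
Lemma kronecker_gap (D : nat) : exists2 c : R, 0 < c &
  forall (l : int) (ys : seq C), l != 0 -> (size ys <= D)%N ->
    (forall m, exists q : {poly int},
       ZC q = l%:~R ^+ m *: \prod_(y <- ys) ('X - (y ^+ m)%:P)) ->
    ln (cnorm (l%:~R : C)) + \sum_(y <- ys) logp (cnorm y) < c ->
  forall y, y \in ys -> y != 0 -> exists2 k, (0 < k)%N & y ^+ k = 1.
Proof.
(* [K] exceeds the coefficients as long as m times the measure is at most 1. [T] codes the vectors
   of D + 1 integers of absolute value at most [K], shifted by [K]. The choice of c ensures m c <= 1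
   for all m <= #|T| + 1. *)
pose K := Num.bound (2 ^+ D * expR 1 : R); pose T := {ffun 'I_D.+1 -> 'I_(K + K).+1}.
exists (#|T|.+1%:R^-1) => [|l ys nz_l sz_ys /choice[q Dq] small].
  by rewrite invr_gt0 ltr0n.
have coef_q (m : 'I_#|T|.+1) i : (absz ((q m.+1)`_i)%R < K)%N.
  have le_q : cnorm (ZC (q m.+1))`_i <= 2 ^+ D * expR 1.
    rewrite Dq (le_trans (cnorm_coef_le _ _ _ nz_l)) //.
    apply: ler_pM; rewrite ?exprn_ge0 ?expR_ge0 ?ler_weXn2l ?ler1n // ler_expR.
    rewrite -mulr_natr -ler_pdivlMr ?ltr0n // mul1r.
    by rewrite (le_trans (ltW small)) // lef_pV2 ?posrE ?ltr0n // ler_nat.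
  rewrite coef_map cnorm_int in le_q.
  rewrite -(ltr_nat R) -[_%:R]/((absz (q m.+1)`_i)%:Z%:~R) abszE.
  by rewrite (le_lt_trans le_q) // archi_boundP // mulr_ge0 ?exprn_ge0 ?expR_ge0.
pose phi (m : 'I_#|T|.+1) : T := [ffun i : 'I_D.+1 => inord (absz ((q m.+1)`_i + K%:Z)%R)].
have /injectivePn[m1 [m2 neq_m eq_phi]] : ~~ injectiveb phi.
  by apply/negP => /injectiveP/leq_card; rewrite card_ord ltnn.
have sz_q m : (size (q m) <= D.+1)%N.
  rewrite -(size_map_inj_poly (@intr_inj C) (rmorph0 _)) Dq.
  rewrite size_scale ?expf_neq0 ?intr_eq0 //.
  rewrite -(big_map (fun y : C => y ^+ m) xpredT (fun y => 'X - y%:P)).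
  by rewrite size_prod_XsubC size_map.
have {}eq_q : q m1.+1 = q m2.+1.
  apply/polyP => i; have [lt_iD|le_Di] := ltnP i D.+1; last first.
    by rewrite !nth_default // (leq_trans _ le_Di).
  have := congr1 (fun f : T => val (f (Ordinal lt_iD))) eq_phi.
  have bd (m : 'I_#|T|.+1) : (absz ((q m.+1)`_i + K%:Z)%R < (K + K).+1)%N.
    by have := coef_q m i; lia.
  rewrite /= !ffunE !inordK ?bd //.
  move: (coef_q m1 i) (coef_q m2 i); move: ((q m1.+1)`_i) ((q m2.+1)`_i) => x y.
  lia.
(* The leading coefficients agree and cancel; unique factorization then compares the roots. *)
have := congr1 ZC eq_q; rewrite !Dq => eq_p.
have /eqP := congr1 lead_coef eq_p.
have monic_ys m : \prod_(y <- ys) ('X - (y ^+ m)%:P) \is monic.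
  by rewrite -(big_map (fun y : C => y ^+ m) xpredT (fun y => 'X - y%:P)) monic_prod_XsubC.
rewrite !lead_coefZ !(monicP (monic_ys _)) !mulr1 => /eqP eq_l.
rewrite eq_l in eq_p; have nz_lm : l%:~R ^+ m2.+1 != 0 :> C by rewrite expf_neq0 ?intr_eq0.
move/(scalerI nz_lm): eq_p.
rewrite -(big_map (fun y : C => y ^+ m1.+1) xpredT (fun y => 'X - y%:P)).
rewrite -(big_map (fun y : C => y ^+ m2.+1) xpredT (fun y => 'X - y%:P)).
move/prod_XsubC_eq/perm_mem => eq_ys.
apply: (@power_map_torsion _ ys m1.+1 m2.+1) => // x ys_x.
have : x ^+ m1.+1 \in [seq y ^+ m2.+1 | y <- ys] by rewrite -eq_ys; apply: map_f.
by case/mapP => y ys_y eq_xy; exists y.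
Qed.
End Kronecker.

(** * The modified Mahler measure *)

Section ModifiedMahler.
Variable R : realType.
Local Notation C := R[i].
Local Notation ZC := (map_poly (intr : int -> C)).
Implicit Types a : Qbarx R.

Lemma TorP z : @Tor R z <-> exists2 n, (0 < n)%N & val z ^+ n = 1.
Proof.
split=> -[n n_gt0 zn1]; exists n => //; first by rewrite -val_QbarxX zn1.
by apply: val_inj; rewrite val_QbarxX zn1.
Qed.

Lemma Tor1 : @Tor R 1%g.
Proof. by exists 1%N. Qed.

Lemma TorM z w : @Tor R z -> @Tor R w -> @Tor R (z * w)%g.
Proof.
move=> /TorP[m m_gt0 zm1] /TorP[n n_gt0 wn1]; apply/TorP.
exists (m * n)%N; first by rewrite muln_gt0 m_gt0.
by rewrite /= exprMn exprM zm1 expr1n mulnC exprM wn1 expr1n mulr1.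
Qed.

Lemma TorV z : @Tor R z -> @Tor R z^-1%g.
Proof.
by move=> /TorP[m m_gt0 zm1]; apply/TorP; exists m => //=; rewrite exprVn zm1 invr1.
Qed.

Lemma mahler_bar_has_inf a : has_inf [set mahler (z * a)%g | z in @Tor R].
Proof.
split; first by exists (mahler (1 * a)%g), 1%g => //; apply: Tor1.
by exists 0 => _ [z _ <-]; apply: mahler_ge0.
Qed.

Lemma mahler_bar_le a z : @Tor R z -> mahler_bar a <= mahler (z * a)%g.
Proof.
move=> Tz; apply: ge_inf; last by exists z.
by have [] := mahler_bar_has_inf a.
Qed.

Lemma mahler_bar_ge0 a : 0 <= mahler_bar a.
Proof.
apply: lb_le_inf; first by have [] := mahler_bar_has_inf a.
by move=> _ [z _ <-]; apply: mahler_ge0.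
Qed.

Lemma mahler_bar_le_mahler a : mahler_bar a <= mahler a.
Proof. by rewrite -{2}[a]mul1g; apply/mahler_bar_le/Tor1. Qed.

Lemma mahler_bar1 : mahler_bar (1%g : Qbarx R) = 0.
Proof.
apply/le_anti; rewrite mahler_bar_ge0 andbT.
by rewrite (le_trans (mahler_bar_le_mahler _)) // mahler_Tor //; apply: Tor1.
Qed.

Lemma mahler_barV_le a : mahler_bar a^-1%g <= mahler_bar a.
Proof.
apply: lb_le_inf; first by have [] := mahler_bar_has_inf a.
move=> _ [z Tz <-]; rewrite -mahlerV invMg.
have -> : (a^-1 * z^-1)%g = (z^-1 * a^-1)%g :> Qbarx R by apply: val_inj; rewrite /= mulrC.
exact/mahler_bar_le/TorV.
Qed.

Lemma mahler_barV a : mahler_bar a^-1%g = mahler_bar a.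
Proof. by apply/le_anti; rewrite mahler_barV_le -{1}[a]invgK mahler_barV_le. Qed.

Lemma mahler_bar_lt a t : mahler_bar a < t -> exists2 z, @Tor R z & mahler (z * a)%g < t.
Proof. by case/(inf_lt (mahler_bar_has_inf a).1) => _ [z Tz <-] lt_t; exists z. Qed.

(** Each of the d roots r satisfies |r|^d = |y| and so contributes one d-th of log+|y|. *)
Lemma mahler_polyXn_sub (d : nat) (y : C) : (0 < d)%N ->
  mahler_poly ('X^d - y%:P) = logp (cnorm y).
Proof.
move=> d_gt0; have [s Ds] := poly_splits ('X^d - y%:P).
rewrite (monicP (monicXnsubC _ d_gt0)) in Ds.
have sz_s : size s = d.
  have := congr1 (fun p : {poly C} => size p) Ds.
  by rewrite scale1r size_prod_XsubC size_XnsubC // => -[].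
rewrite Ds mahler_polyE ?oner_eq0 // cnorm1 ln1 add0r.
apply: (pmulrnI d_gt0); rewrite -sumrMnl.
rewrite (eq_big_seq (fun=> logp (cnorm y))) => [|r s_r]; last first.
  rewrite -logpX ?cnorm_ge0 // -cnormX; congr (logp (cnorm _)); apply/eqP.
  rewrite -subr_eq0; have : root (1 *: \prod_(z <- s) ('X - z%:P)) r.
    by rewrite scale1r root_prod_XsubC.
  by rewrite -Ds rootE !hornerE.
by rewrite big_const_seq count_predT sz_s iter_addr_0.
Qed.

Lemma mahler_poly_prodXn_sub (c : C) (d : nat) (ys : seq C) : c != 0 -> (0 < d)%N ->
  mahler_poly (c *: \prod_(y <- ys) ('X^d - y%:P)) =
  ln (cnorm c) + \sum_(y <- ys) logp (cnorm y).
Proof.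
move=> nz_c d_gt0; elim: ys => [|y ys IHys].
  by have := mahler_polyE [::] nz_c; rewrite !big_nil.
have nz_y (w : C) : 'X^d - w%:P != 0 by rewrite -size_poly_gt0 size_XnsubC.
have nz_prod : c *: \prod_(w <- ys) ('X^d - w%:P) != 0.
  by rewrite scaler_eq0 negb_or nz_c /= prodf_seq_neq0; apply/allP => w _; apply: nz_y.
rewrite !big_cons scalerAr (mahler_polyM (nz_y y) nz_prod) IHys mahler_polyXn_sub //.
by rewrite addrCA.
Qed.

(** Replacing the roots of a block by their product cannot raise the sum of the log+, which is
    subadditive on products. *)
Lemma block_mahler_le (f : {poly int}) D (bs : seq (seq C)) : f != 0 ->
    block_datum f D bs ->
  ln (cnorm ((lead_coef f)%:~R : C)) + \sum_(b <- bs) logp (cnorm (\prod_(z <- b) z))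
    <= mahler_poly (ZC f).
Proof.
move=> nz_f [-> _ _]; rewrite mahler_polyE ?intr_eq0 ?lead_coef_eq0 // lerD2l.
by rewrite big_flatten; apply: ler_sum => b _; apply: logp_prod.
Qed.

Lemma Qbarx_torsion_quotient a (y : C) n : (0 < n)%N -> y ^+ n = val a ^+ n ->
  exists2 z, @Tor R z & val (z * a)%g = y.
Proof.
move=> n_gt0 eq_y; have nz_a := Qbarx_neq0 a.
pose x := y / val a.
have xn1 : x ^+ n = 1 by rewrite expr_div_n eq_y divff // expf_neq0.
have x_Qbarx : x \in @is_Qbarx R.
  apply/andP; split.
    by apply: contraTneq (oner_neq0 C) => x0; rewrite -xn1 x0 expr0n gtn_eqF ?eqxx.
  apply/asboolP; exists ('X^n - 1); first by rewrite -size_poly_gt0 size_XnsubC.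
  by rewrite rmorphB rmorph1 /= map_polyXn rootE !hornerE xn1 subrr.
exists (exist _ x x_Qbarx : Qbarx R); last by rewrite /= divfK.
by apply/TorP; exists n.
Qed.

(** [c] is the gap for the bound [D], which is attached to [a] alone. It must not depend on the
    factorization, because it determines the exponent with which a factorization is selected. *)
Lemma mahler_bar_le_of_small_factors a : exists2 c : R, 0 < c &
  forall g (s : seq (Qbarx R)), (g * \prod_(u <- s) u)%g = a ->
    (forall u, u \in s -> mahler u < c) -> mahler_bar a <= mahler g.
Proof.
have [_ /asboolP alg_a] := andP (valP a).
have [D HD] := block_decomposition alg_a.
have [c c_gt0 Hc] := kronecker_gap R D.
exists c => // g s prod_gs small.
pose us := map val (g :: s).
have prod_us : \prod_(u <- us) u = val a.
  rewrite /us /= big_cons -prod_gs /=; congr (_ * _).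
  by elim: (s) => [|u t IHt]; rewrite ?big_nil //= !big_cons IHt.
have [|n [nu [n_gt0 Dan Hnu]]] := HD us _ prod_us.
  by move=> _ /mapP[u _ ->]; have [_ /asboolP] := andP (valP u).
have datum (u : Qbarx R) : u \in g :: s -> exists bs, block_datum (minpolyZ u) D bs /\
    exists2 b, b \in bs & (0 < size b)%N /\ (\prod_(z <- b) z) ^+ n = nu (val u) ^+ size b.
  by move=> s_u; have [irr_u _ u0] := minpolyZP u; apply: Hnu => //; apply: map_f.
have nz_nu u : u \in g :: s -> nu (val u) != 0.
  move=> s_u; have : val a ^+ n != 0 by rewrite expf_neq0 ?Qbarx_neq0.
  by rewrite Dan prodf_seq_neq0 => /allP/(_ (val u)); apply; apply: map_f.
(* The gap makes a block product of u a root of unity, and its [n]-th power is a positive power of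
   the norm of u. *)
have tor_nu u : u \in s -> exists2 k, (0 < k)%N & nu (val u) ^+ k = 1.
  move=> s_u; have gs_u : u \in g :: s by rewrite inE s_u orbT.
  have [bs [bsP [b bs_b [b_gt0 Db]]]] := datum u gs_u.
  have nz_f := minpolyZ_neq0 u; have [_ sz_bs bs_poly] := bsP.
  have nz_b : \prod_(z <- b) z != 0.
    apply: contra_neq (expf_neq0 (size b) (nz_nu u gs_u)) => b0.
    by rewrite -Db b0 expr0n gtn_eqF.
  pose ys := [seq \prod_(z <- b) z | b <- bs].
  have ys_b : \prod_(z <- b) z \in ys by apply: map_f.
  have [||||k k_gt0 bk1] := Hc (lead_coef (minpolyZ u)) ys _ _ _ _ _ ys_b nz_b.
  - by rewrite lead_coef_eq0.
  - by rewrite size_map.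
  - by move=> m; have [q Dq] := bs_poly m; exists q; rewrite big_map.
  - by rewrite big_map (le_lt_trans (block_mahler_le nz_f bsP)) //; apply: small.
  exists (size b * k)%N; first by rewrite muln_gt0 b_gt0.
  by rewrite exprM -Db exprAC bk1 expr1n.
have [e e_gt0 tor_s] : exists2 e, (0 < e)%N & (\prod_(u <- s) nu (val u)) ^+ e = 1.
  elim: (s) tor_nu => [|u t IHt] tor_t; first by exists 1%N; rewrite ?big_nil.
  have [|e e_gt0 De] := IHt; first by move=> v t_v; apply: tor_t; rewrite inE t_v orbT.
  have [k k_gt0 Dk] := tor_t u (mem_head _ _).
  exists (e * k)%N; first by rewrite muln_gt0 e_gt0.
  by rewrite big_cons exprMn mulnC exprM Dk expr1n mul1r mulnC exprM De expr1n.
have [bs [bsP [b bs_b [b_gt0 Db]]]] := datum g (mem_head _ _).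
set y := \prod_(z <- b) z in Db; set d := size b in b_gt0 Db.
(* Since y^n = nu(g)^d and a^n is nu(g) times an element killed by [e], the powers of [r] and [a]
   with exponent d n e agree. *)
pose r := d.-root y; have Dr : r ^+ d = y by rewrite rootCK.
have [||z Tz Dz] := @Qbarx_torsion_quotient a r (d * (n * e)).
- by rewrite !muln_gt0 b_gt0 n_gt0.
- rewrite [LHS]exprM Dr [LHS]exprM Db -[LHS]exprM mulnCA [RHS]exprM Dan.
  rewrite /us /= big_cons big_map /=.
  by rewrite exprMn [X in _ * _ ^+ X]mulnC [X in _ * X]exprM tor_s expr1n mulr1.
(* The block polynomial for m = 1, with X replaced by X^d, has integer coefficients, vanishes at [r]
   and has measure at most M(g). *)
have [_ _ /(_ 1%N)[q]] := bsP; rewrite expr1 => Dq.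
have nz_f := minpolyZ_neq0 g; set l := (lead_coef (minpolyZ g))%:~R in Dq.
have nz_l : l != 0 :> C by rewrite intr_eq0 lead_coef_eq0.
have Dqd : ZC (q \Po 'X^d) = l *: \prod_(w <- [seq \prod_(z <- b) z | b <- bs]) ('X^d - w%:P).
  rewrite map_comp_poly map_polyXn Dq big_map comp_polyZ rmorph_prod /=; congr (_ *: _).
  by apply: eq_bigr => x _; rewrite expr1 comp_polyB comp_polyX comp_polyC.
have nz_Xd (w : C) : 'X^d - w%:P != 0 by rewrite -size_poly_gt0 size_XnsubC.
apply: (le_trans (mahler_bar_le a Tz)).
apply: (le_trans (mahler_le_root (q := q \Po 'X^d) _ _)).
- rewrite -(ZC_eq0 R) Dqd scaler_eq0 negb_or nz_l /= prodf_seq_neq0.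
  by apply/allP => w _; apply: nz_Xd.
- rewrite Dz Dqd rootZ // (big_rem y) ?rootM; last exact: map_f.
  by rewrite rootE !hornerE Dr subrr eqxx.
rewrite Dqd mahler_poly_prodXn_sub // big_map.
exact: block_mahler_le bsP.
Qed.
End ModifiedMahler.

(** * The norms of factorizations *)

Lemma fsbig_nat_bound (T : Type) (idx : T) (op : Monoid.com_law idx) (F : nat -> T) N :
  (forall n, (N <= n)%N -> F n = idx) ->
  \big[op/idx]_(n \in [set: nat]) F n = \big[op/idx]_(n < N) F n.
Proof.
move=> F1; rewrite fsbig_ord; apply/esym/fsbig_widen => // n [_ /= /negP].
by rewrite -leqNgt => /F1.
Qed.

Lemma ereal_gt0P (R : realType) (x : \bar R) : (0 < x)%E ->
  (exists2 r, 0 < r & x = r%:E) \/ x = +oo%E.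
Proof. by case: x => [r| |] //; [left; exists r | right]. Qed.

Section Norms.
Variable R : realType.
Local Notation Q := (Qbarx R).
Implicit Types (phi psi : Q -> R) (s : nat -> Q) (a : Q) (r : R).

Lemma almost_oneP s : almost_one s <-> exists N, forall n, (N <= n)%N -> s n = 1%g.
Proof.
split=> [fin_s|[N sN]]; last first.
  apply: (sub_finite_set _ (finite_II N)) => n /=.
  by rewrite ltnNge; apply: contra_notN => /sN.
exists (\max_(n <- fset_set [set n | s n <> 1%g]) n).+1 => n lt_n.
apply: contrapT => sn; move: lt_n; apply/negP; rewrite -leqNgt.
by apply: (leq_bigmax_seq (F := id)) => //; rewrite in_fset_set // inE.
Qed.

Definition single a : nat -> Q := fun n => if n is 0%N then a else 1%g.

Lemma tau_bound s N : (forall n, (N <= n)%N -> s n = 1%g) ->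
  tau s = (\prod_(n < N) s n)%g.
Proof. exact: fsbig_nat_bound. Qed.

Lemma single_fiber a : (@almost_one R `&` @tau R @^-1` [set a]) (single a).
Proof.
have single1 n : (1 <= n)%N -> single a n = 1%g by case: n.
split; first by apply/almost_oneP; exists 1%N.
by rewrite /= (tau_bound single1) big_ord1.
Qed.

Section Admissible.
Variable phi : Q -> R.
Hypothesis adm_phi : @admissible R phi.

Let phi_ge0 a : 0 <= phi a. Proof. by case: adm_phi. Qed.
Let phi1 : phi 1%g = 0. Proof. by case: adm_phi. Qed.

Lemma seq_norm_fin r s N : 0 < r -> (forall n, (N <= n)%N -> s n = 1%g) ->
  seq_norm phi r%:E s = (\sum_(n < N) phi (s n) `^ r) `^ r^-1.
Proof.
move=> r_gt0 sN; rewrite /seq_norm; congr (_ `^ _); apply: fsbig_nat_bound => n le_Nn.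
by rewrite sN // phi1 powR0 // gt_eqF.
Qed.

Lemma seq_norm_pinfty_le s v : 0 <= v -> (forall n, phi (s n) <= v) ->
  seq_norm phi +oo%E s <= v.
Proof. by move=> v_ge0 le_v; apply: bigmax_le. Qed.

Lemma le_seq_norm_pinfty s n : almost_one s -> phi (s n) <= seq_norm phi +oo%E s.
Proof.
move=> fin_s; rewrite /seq_norm.
have fin_phi : finite_set ([set: nat] `&` (fun n => phi (s n)) @^-1` [set~ 0]).
  apply: sub_finite_set fin_s => m [_ /=]; apply: contra_not => ->; exact: phi1.
(* Entries where [phi] vanishes lie outside the support of the maximum; for them its initial value 0
   suffices. *)
have [-> |nz_n] := eqVneq (phi (s n)) 0; first exact: bigmax_ge_id.
apply: (@le_bigmax_seq _ _ _ _ 0 n xpredT (fun n => phi (s n))) => //.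
by rewrite in_finite_support // inE; split=> //=; apply/eqP.
Qed.

Lemma powR_le_inv r x y : 0 < r -> 0 <= x -> 0 <= y -> x <= y `^ r -> x `^ r^-1 <= y.
Proof.
move=> r_gt0 x_ge0 y_ge0 le_xy.
have -> : y = (y `^ r) `^ r^-1 by rewrite -powRrM mulfV ?powRr1 // gt_eqF.
by apply: ge0_ler_powR; rewrite ?nnegrE ?powR_ge0 ?invr_ge0 // ltW.
Qed.

Lemma powR_lt_inv r x y : 0 < r -> 0 <= x -> 0 <= y -> x `^ r^-1 < y -> x < y `^ r.
Proof.
move=> r_gt0 x_ge0 y_ge0; rewrite !ltNge; apply: contra => le_yx.
have -> : y = (y `^ r) `^ r^-1 by rewrite -powRrM mulfV ?powRr1 // gt_eqF.
by apply: ge0_ler_powR; rewrite ?nnegrE ?powR_ge0 ?invr_ge0 // ltW.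
Qed.

Lemma seq_norm_ge0 x s : 0 <= seq_norm phi x s.
Proof. by case: x => [r||] //=; [apply: powR_ge0 | apply: bigmax_ge_id]. Qed.

Lemma le_seq_norm x s n : (0 < x)%E -> almost_one s -> phi (s n) <= seq_norm phi x s.
Proof.
move=> /ereal_gt0P[[r r_gt0 ->]|->]; last exact: le_seq_norm_pinfty.
move=> /almost_oneP[N sN].
(* The range is enlarged so that it contains the index [n]. *)
have sNn m : (maxn N n.+1 <= m)%N -> s m = 1%g by rewrite geq_max => /andP[/sN].
rewrite (seq_norm_fin r_gt0 sNn); set S := \sum_(_ < _) _.
have -> : phi (s n) = (phi (s n) `^ r) `^ r^-1 by rewrite -powRrM mulfV ?powRr1 // gt_eqF.
have lt_n : (n < maxn N n.+1)%N by rewrite leq_maxr.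
have S_ge0 : 0 <= S by apply: sumr_ge0 => i _; apply: powR_ge0.
apply: ge0_ler_powR; rewrite ?nnegrE ?powR_ge0 ?invr_ge0 ?(ltW r_gt0) //.
rewrite /S (bigD1 (Ordinal lt_n)) //= lerDl.
by apply: sumr_ge0 => i _; apply: powR_ge0.
Qed.

Lemma seq_norm_single x a : (0 < x)%E -> seq_norm phi x (single a) = phi a.
Proof.
move=> x_gt0; have [fin_a _] := single_fiber a.
apply/le_anti; rewrite (le_seq_norm 0%N x_gt0 fin_a) andbT.
have [[r r_gt0 ->]|->] := ereal_gt0P x_gt0; last first.
  by apply: seq_norm_pinfty_le => // -[|n] //=; rewrite phi1.
rewrite (@seq_norm_fin _ _ 1) // => [|[]//].
by rewrite big_ord1 /= -powRrM mulfV ?powRr1 // gt_eqF.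
Qed.

Lemma seq_norm_has_inf x a :
  has_inf [set seq_norm phi x s | s in @almost_one R `&` @tau R @^-1` [set a]].
Proof.
split; first by exists (seq_norm phi x (single a)), (single a) => //; apply: single_fiber.
by exists 0 => _ [s _ <-]; apply: seq_norm_ge0.
Qed.

Lemma elt_norm_le x s : almost_one s -> elt_norm phi x (tau s) <= seq_norm phi x s.
Proof.
move=> fin_s; apply: ge_inf; first by have [] := seq_norm_has_inf x (tau s).
by exists s.
Qed.

Lemma le_elt_norm x a v :
    (forall s, almost_one s -> tau s = a -> v <= seq_norm phi x s) ->
  v <= elt_norm phi x a.
Proof.
move=> le_v; apply: lb_le_inf; first by have [] := seq_norm_has_inf x a.
by move=> _ [s [fin_s ts] <-]; apply: le_v.
Qed.

Lemma elt_norm_le_self x a : (0 < x)%E -> elt_norm phi x a <= phi a.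
Proof.
move=> x_gt0; have [fin_a ta] := single_fiber a.
by rewrite -(seq_norm_single a x_gt0) -{1}ta; apply: elt_norm_le.
Qed.

End Admissible.

Lemma seq_norm_mono phi psi x s : admissible phi -> admissible psi ->
    (forall b, phi b <= psi b) -> (0 < x)%E -> almost_one s ->
  seq_norm phi x s <= seq_norm psi x s.
Proof.
move=> adm_phi adm_psi le_phi x_gt0 fin_s; have [phi_ge0 _ _] := adm_phi.
have [[r r_gt0 ->]|->] := ereal_gt0P x_gt0; last first.
  apply: seq_norm_pinfty_le => [|n]; first exact: seq_norm_ge0.
  exact: le_trans (le_phi _) (le_seq_norm_pinfty adm_psi n fin_s).
have [N sN] := (almost_oneP s).1 fin_s.
rewrite (seq_norm_fin adm_phi r_gt0 sN) (seq_norm_fin adm_psi r_gt0 sN).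
have r_ge0 := ltW r_gt0.
have sum_ge0 (f : Q -> R) : 0 <= \sum_(n < N) f (s n) `^ r.
  by apply: sumr_ge0 => n _; apply: powR_ge0.
apply: ge0_ler_powR; rewrite ?nnegrE ?invr_ge0 ?sum_ge0 //.
apply: ler_sum => n _; apply: ge0_ler_powR; rewrite ?nnegrE //.
exact: le_trans (phi_ge0 _) (le_phi _).
Qed.

(** * Membership of [mahler_bar] in S(M) *)

Lemma mahler_admissible : admissible (@mahler R).
Proof.
by split=> [a||a]; [apply: mahler_ge0 | apply/mahler_Tor/Tor1 | rewrite mahlerV].
Qed.

Lemma mahler_bar_admissible : admissible (@mahler_bar R).
Proof.
by split=> [a||a]; [apply: mahler_bar_ge0 | apply: mahler_bar1 | rewrite mahler_barV].
Qed.

(* The twists multiply to a root of unity, whose inverse is stored in entry [N]. *)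
Lemma mahler_bar_twist s N (t : nat -> R) :
    (forall n, (N <= n)%N -> s n = 1%g) ->
    (forall n, mahler_bar (s n) < t n) ->
  exists s' : nat -> Q, [/\ forall n, (N < n)%N -> s' n = 1%g, tau s' = tau s,
    forall n, (n < N)%N -> mahler (s' n) < t n & mahler (s' N) = 0].
Proof.
move=> sN lt_t.
have /choice[z Dz] n : exists z, @Tor R z /\ mahler (z * s n)%g < t n.
  by have [z Tz lt_z] := mahler_bar_lt (lt_t n); exists z.
pose zN : Q := (\prod_(n < N) z n)%g.
have TzN : @Tor R zN.
  by apply: big_ind => [||n _]; [apply: Tor1 | apply: TorM | case: (Dz n)].
pose s' n : Q := if (n < N)%N then (z n * s n)%g else if n == N then zN^-1%g else 1%g.
exists s'; split.
- by move=> n lt_Nn; rewrite /s' ltnNge (ltnW lt_Nn) gtn_eqF.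
- rewrite (tau_bound sN) (@tau_bound s' N.+1); last first.
    by move=> n lt_Nn; rewrite /s' ltnNge (ltnW lt_Nn) gtn_eqF.
  rewrite big_ord_recr /= [s' N]/s' ltnn eqxx.
  rewrite (eq_bigr (fun n : 'I_N => z n * s n)%g) => [|n _]; last by rewrite /s' ltn_ord.
  rewrite big_split /= -/zN; apply: val_inj => /=.
  by rewrite mulrAC mulfV ?mul1r // Qbarx_neq0.
- by move=> n lt_nN; rewrite /s' lt_nN; case: (Dz n).
by rewrite /s' ltnn eqxx; apply/mahler_Tor/TorV.
Qed.

(** One inequality is monotonicity. For the other, twisting exceeds the norm by an arbitrarily small
    amount, spread over the entries. *)
Lemma elt_norm_mahler_bar x a : (0 < x)%E ->
  elt_norm (@mahler_bar R) x a = elt_norm (@mahler R) x a.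
Proof.
have adm := mahler_admissible; have admb := mahler_bar_admissible.
move=> x_gt0; apply/le_anti/andP; split.
  apply: le_elt_norm => s fin_s <-; apply: le_trans (elt_norm_le _ x fin_s) _.
  exact: (seq_norm_mono admb adm (@mahler_bar_le_mahler R) x_gt0 fin_s).
apply: le_elt_norm => s fin_s <-; have [N sN] := (almost_oneP s).1 fin_s.
apply/ler_addgt0Pr => e e_gt0; set v := _ + e.
have lt_v : seq_norm (@mahler_bar R) x s < v by rewrite ltrDl.
have v_ge0 : 0 <= v by apply: le_trans (ltW lt_v); apply: seq_norm_ge0.
have fin_of s' : (forall n, (N < n)%N -> s' n = 1%g) -> almost_one s'.
  by move=> s'N; apply/almost_oneP; exists N.+1.
move: (v) lt_v v_ge0 => {v e e_gt0} v.
have [[r r_gt0 ->]|->] := ereal_gt0P x_gt0; last first.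
  move=> lt_v v_ge0.
  have [n|s' [s'N <- lt_s' s'N0]] := @mahler_bar_twist s N (fun=> v) sN.
    exact: le_lt_trans (le_seq_norm_pinfty admb n fin_s) lt_v.
  apply: le_trans (elt_norm_le _ _ (fin_of _ s'N)) _.
  apply: seq_norm_pinfty_le => // n; case: (ltngtP n N) => [/lt_s'/ltW //|/s'N ->|->].
    by case: adm => _ -> _.
  by rewrite s'N0.
move=> lt_v v_ge0.
have r_ge0 := ltW r_gt0.
pose S := \sum_(n < N) mahler_bar (s n) `^ r.
have S_ge0 : 0 <= S by apply: sumr_ge0 => n _; apply: powR_ge0.
have lt_S : S < v `^ r.
  by apply: powR_lt_inv => //; rewrite -(seq_norm_fin admb r_gt0 sN).
(* Each entry receives the share [d] of the slack in the sum of r-th powers; [N.+1] keeps the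
   denominator non-zero for N = 0. *)
pose d := (v `^ r - S) / N.+1%:R.
have d_gt0 : 0 < d by rewrite divr_gt0 ?subr_gt0 ?ltr0n.
pose t n := (mahler_bar (s n) `^ r + d) `^ r^-1.
have tr n : t n `^ r = mahler_bar (s n) `^ r + d.
  by rewrite /t -powRrM mulVf ?gt_eqF // powRr1 // addr_ge0 ?powR_ge0 // ltW.
have [n|s' [s'N <- lt_s' s'N0]] := @mahler_bar_twist s N t sN.
  rewrite ltNge; apply/negP => le_t.
  have : t n `^ r <= mahler_bar (s n) `^ r.
    by apply: ge0_ler_powR; rewrite ?nnegrE ?powR_ge0 ?mahler_bar_ge0.
  by rewrite tr leNgt ltrDl d_gt0.
apply: le_trans (elt_norm_le _ _ (fin_of _ s'N)) _.
rewrite (@seq_norm_fin _ adm r s' N.+1 r_gt0) //.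
apply: powR_le_inv => //; first by apply: sumr_ge0 => n _; apply: powR_ge0.
rewrite big_ord_recr /= s'N0 powR0 ?gt_eqF // addr0.
apply: (@le_trans _ _ (\sum_(n < N) (mahler_bar (s n) `^ r + d))).
  apply: ler_sum => n _; rewrite -tr.
  apply: ge0_ler_powR; rewrite ?nnegrE ?powR_ge0 ?mahler_ge0 //.
  exact: ltW (lt_s' _ _).
rewrite big_split /= sumr_const card_ord -/S -lerBrDl.
rewrite -mulr_natl /d mulrCA ler_piMr ?subr_ge0 ?(ltW lt_S) //.
by rewrite ler_pdivrMr ?ltr0n // mul1r ler_nat.
Qed.

(** * Minimality of [mahler_bar] *)

Lemma mahler_bar_le_calS psi a : calS (@mahler R) psi -> mahler_bar a <= psi a.
Proof.
move=> [adm_psi eq_psi]; rewrite leNgt; apply/negP => lt_psi.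
have [c c_gt0 Hc] := mahler_bar_le_of_small_factors a.
have psi_ge0 : 0 <= psi a by case: adm_psi.
pose B := (psi a + mahler_bar a) / 2.
have [lt_pB lt_Bm] : psi a < B /\ B < mahler_bar a by rewrite /B; split; lra.
have B_gt0 : 0 < B := le_lt_trans psi_ge0 lt_pB.
(* [k] is chosen to make r (ln B - ln c) < ln 2, that is, B^r < 2 c^r; the added 1 makes it positive
   and the inequality strict. *)
pose k := `|ln B - ln c| + 1.
have k_gt0 : 0 < k by rewrite ltr_wpDl.
pose r := ln 2 / k.
have ln2_gt0 : 0 < ln 2 :> R by rewrite ln_gt0 // ltr1n.
have r_gt0 : 0 < r by rewrite divr_gt0.
(* With this exponent, two entries of Mahler measure at least [c] already have
   norm greater than [B]. *)
have lt_Br : B `^ r < c `^ r *+ 2.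
  rewrite /powR !gt_eqF // -mulr_natl -[2%:R](@lnK R) ?posrE ?ltr0n // -expRD ltr_expR.
  rewrite -ltrBlDr -mulrBr /r -mulrA gtr_pMr // mulrC ltr_pdivrMr // mul1r.
  by rewrite /k ltr_pwDr // ler_norm.
have adm := mahler_admissible; have [_ M1 _] := adm.
(* psi(a) bounds psi_r(a) = M_r(a), so some factorization has M-norm below [B]. *)
have lt_elt : elt_norm (@mahler R) r%:E a < B.
  by rewrite -eq_psi ?lte_fin // (le_lt_trans (elt_norm_le_self adm_psi _ _)) ?lte_fin.
have [_ [s [fin_s ts] <-]] := inf_lt (seq_norm_has_inf (@mahler R) r%:E a).1 lt_elt.
have [N sN] := (almost_oneP s).1 fin_s; rewrite (seq_norm_fin adm r_gt0 sN) => lt_s.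
have sum_ge0 (P : pred 'I_N) : 0 <= \sum_(n < N | P n) mahler (s n) `^ r.
  by apply: sumr_ge0 => n _; apply: powR_ge0.
have {}lt_s : \sum_(n < N) mahler (s n) `^ r < B `^ r.
  by apply: powR_lt_inv => //; apply: ltW.
have prod_s : (\prod_(n < N) s n)%g = a by rewrite -(tau_bound sN).
(* If no entry reaches [c], the choice g = 1 contradicts mahler_bar(a) > B > 0. Otherwise the large
   entry is unique and serves as g. *)
have [/existsP[i ci]|/existsPn small] :=
  boolP [exists i : 'I_N, c <= mahler (s i)]; last first.
  have : mahler_bar a <= mahler 1%g.
    apply: (Hc _ [seq s (val n) | n <- index_enum 'I_N]).
      by rewrite mul1g big_map.
    by move=> _ /mapP[n _ ->]; rewrite ltNge small.
  by rewrite M1 leNgt (lt_trans B_gt0 lt_Bm).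
have small (j : 'I_N) : j != i -> mahler (s j) < c.
  move=> neq_ji; rewrite ltNge; apply/negP => cj; move: lt_s; apply/negP; rewrite -leNgt.
  have pow_c n : c <= mahler (s n) -> c `^ r <= mahler (s n) `^ r.
    by move=> cn; apply: ge0_ler_powR; rewrite ?nnegrE ?mahler_ge0 ?(ltW r_gt0) ?(ltW c_gt0).
  apply: le_trans (ltW lt_Br) _; rewrite mulr2n (bigD1 i) //= (bigD1 j) //=.
  by rewrite lerD ?pow_c // ler_wpDr ?pow_c.
have le_i : mahler_bar a <= mahler (s i).
  apply: (Hc _ [seq s (val n) | n <- index_enum 'I_N & n != i]).
    by rewrite big_map big_filter -prod_s [RHS](bigD1 i).
  by move=> _ /mapP[n /[!mem_filter] /andP[ni _] ->]; apply: small.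
have : mahler (s i) `^ r < B `^ r.
  by apply: le_lt_trans lt_s; rewrite (bigD1 i) //= lerDl.
apply/negP; rewrite -leNgt; apply: ge0_ler_powR;
  rewrite ?nnegrE ?mahler_ge0 ?(ltW r_gt0) ?(ltW B_gt0) //.
exact: le_trans (ltW lt_Bm) le_i.
Qed.

End Norms.

Theorem corollary1p3 (R : realType) :
  calS (@mahler R) (@mahler_bar R) /\
  (forall psi : Qbarx R -> R, calS (@mahler R) psi ->
     forall a : Qbarx R, mahler_bar a <= psi a).
Proof.
split; last by move=> psi Spsi a; apply: mahler_bar_le_calS.
split; first exact: mahler_bar_admissible.
by move=> x x_gt0 a; apply: elt_norm_mahler_bar.
Qed.
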